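(* Let $E$ be an infinite-dimensional Banach space with a $C^1$ (away from the origin) strictly convex equivalent norm $\|\cdot\|$ and with a $1$-suppression unconditional basis $\{e_n\}_{n\in\mathbb{N}}$. Let $U$ be an open subset of $E$, $f:U\to\mathbb{R}^d$ a $C^1$ function and $\varepsilon:U\to(0,\infty)$ a continuous function. Then there exists a $C^1$ function $g:U\to\mathbb{R}^d$ such that: (1) $\|f(x)-g(x)\|\leq\varepsilon(x)$ for every $x\in U$; (2) $\|Df(x)-Dg(x)\|\leq\varepsilon(x)$ for every $x\in U$; (3) the critical set $C_g:=\{x\in U: Dg(x)\ \text{is not surjective}\}$ is locally contained in a finite union of complemented subspaces of infinite codimension in $E$: for every $x\in U$ there exist an open neighbourhood $V_x$ of $x$ and finitely many closed subspaces $E_1,\dots,E_{n_x}$ of $E$, each complemented in $E$ and of infinite codimension, with $C_g\cap V_x\subseteq\bigcup_{j=1}^{n_x}E_j$.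
   Context: A basis $\{e_n\}$ is $1$-suppression unconditional if it is a Schauder basis such that for every $x=\sum_j x_je_j\in E$ and every $j_0\in\mathbb{N}$, $\left\|\sum_{j\neq j_0}x_je_j\right\|\leq\left\|\sum_j x_je_j\right\|$. The norm on $\mathbb{R}^d$ is Euclidean; norms of linear maps are operator norms. *)

(* Defs.v *)
From HB Require Import structures.
From mathcomp Require Import all_boot all_order all_algebra.
From mathcomp Require Import all_classical all_reals all_analysis.
Set Implicit Arguments. Unset Strict Implicit. Unset Printing Implicit Defensive.
Import Order.TTheory GRing.Theory Num.Theory.
Import numFieldNormedType.Exports.
Local Open Scope classical_set_scope.
Local Open Scope ring_scope.

Section Defs.
Variable R : realType.

Definition eucl (d : nat) (w : 'rV[R]_d) : R :=
  Num.sqrt (\sum_(i < d) (w ord0 i) ^+ 2).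

Definition opnorm (E : normedModType R) (F : Type) (nF : F -> R)
  (L : E -> F) : R :=
  sup [set nF (L v) | v in [set v : E | `|v| <= 1]].

Definition C1_on (E F : normedModType R) (nF : F -> R) (U : set E)
  (f : E -> F) : Prop :=
  (forall x, U x -> differentiable f x) /\
  (forall x, U x -> forall eps : R, 0 < eps -> exists2 delta : R, 0 < delta &
     forall y, U y -> `|y - x| < delta ->
       opnorm nF (fun v => 'd f y v - 'd f x v) < eps).

Definition norm_C1_away_from_0 (E : normedModType R) : Prop :=
  C1_on (fun r : R => `|r|) [set x : E | x != 0] (fun x : E => `|x|).

Definition strictly_convex_norm (E : normedModType R) : Prop :=
  forall x y : E, `|x| = 1 -> `|y| = 1 -> x != y -> `|(2 : R)^-1 *: (x + y)| < 1.

Definition span (E : normedModType R) (s : seq E) : set E :=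
  [set x | exists c : nat -> R, x = \sum_(i < size s) c i *: s`_i].

Definition infinite_dimensional (E : normedModType R) : Prop :=
  forall s : seq E, exists x : E, ~ span s x.

Definition linear_subspace (E : normedModType R) (S : set E) : Prop :=
  S 0 /\ (forall x y, S x -> S y -> S (x + y)) /\
  (forall (a : R) x, S x -> S (a *: x)).

Definition closed_subspace (E : normedModType R) (S : set E) : Prop :=
  linear_subspace S /\ closed S.

Definition complemented (E : normedModType R) (S : set E) : Prop :=
  exists T : set E, closed_subspace T /\
    (forall x, S x -> T x -> x = 0) /\
    (forall x, exists s t, S s /\ T t /\ x = s + t).

Definition infinite_codim (E : normedModType R) (S : set E) : Prop :=
  forall s : seq E, exists x : E,
    ~ (exists y z, S y /\ span s z /\ x = y + z).

Definition series_to (E : normedModType R) (a : nat -> R) (e : nat -> E)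
  (x : E) : Prop :=
  (fun N : nat => \sum_(i < N) a i *: e i) @ \oo --> x.

Definition schauder_basis (E : normedModType R) (e : nat -> E) : Prop :=
  forall x : E, exists! a : nat -> R, series_to a e x.

Definition one_suppression_unconditional (E : normedModType R)
  (e : nat -> E) : Prop :=
  schauder_basis e /\
  forall (x : E) (a : nat -> R) (j0 : nat) (y : E),
    series_to a e x ->
    series_to (fun j => if j == j0 then 0 else a j) e y ->
    `|y| <= `|x|.

Definition critical_set (E : normedModType R) (d : nat) (U : set E)
  (g : E -> 'rV[R]_d) : set E :=
  [set x | U x /\ ~ (forall w : 'rV[R]_d, exists v : E, 'd g x v = w)].

End Defs.

(* Main.v *)
(** The map [f] is precomposed with a cut-off [Psi] and perturbed along countably many directions.

    Every point [x] carries a scale [r x > 0] (a C^1, Lipschitz function with a small constant)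
    within which [f] and [Df] hardly move.  [Psi x] multiplies the [n]-th coordinate of [x] by
    [1 - w n x], where [w n x] vanishes while the tail [T_n x] is large compared with [r] and is [1]
    once the tail is small; so [Psi] is locally finite-dimensional.  The weight [w n] is evaluated
    at the part [Y n x] of the output already constructed: its derivative then vanishes on every
    direction that [Y n] kills.  Since the norm is C^1, the basis is shrinking (Ekeland's principle
    gives a point where the gradient of the squared norm almost equals a prescribed functional),
    hence [Df x (T_n v)] is small and [D(f o Psi)] stays close to [Df].

    Put [g = f o Psi + p], where the component [p_a] is a sum of bumps in the squared tails
    [N2 (T_n x)], [n = a mod d].  Suppose a functional [lam] vanishes on the range of [Dg y].
    A triangular system yields, for each [k], a direction [e_k + (terms of index < k)] killed by
    [D Psi y]; along it [lam o Dp y] gives a relation between the coefficients of the bumps.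
    By strict convexity the partial derivative of [N2] in the direction [e_k] is nonzero when
    [y_k <> 0], and Abel summation then shows that the partial sums of these coefficients vanish at
    every [k] with [y_k <> 0].  The coefficients decrease geometrically, so this cannot happen at
    two places when the next coefficient has maximal weight.  Hence [y] has only zero coordinates
    beyond some [M] along one of the [2 d] residue classes modulo [2 d]. *)

Require Import Defs.
From HB Require Import structures.
From mathcomp Require Import all_boot all_order all_algebra.
From mathcomp Require Import all_classical all_reals all_analysis.
From mathcomp Require Import ring lra.
Set Implicit Arguments. Unset Strict Implicit. Unset Printing Implicit Defensive.
Import Order.TTheory GRing.Theory Num.Theory.
Import numFieldNormedType.Exports.
Local Open Scope classical_set_scope.
Local Open Scope ring_scope.

(** * Strict derivatives *)

Section BoundedLinear.
Variable R : realType.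

(** A predicate on bare functions, so that derivatives can be written as explicit lambda terms with
    no linear structure to rebuild each time. *)
Definition blin (E F : normedModType R) (A : E -> F) : Prop :=
  (forall u v, A (u + v) = A u + A v) /\ (forall (a : R) u, A (a *: u) = a *: A u) /\
  exists2 K : R, 0 <= K & forall v, `|A v| <= K * `|v|.

Section Blin.
Variables E F : normedModType R.
Implicit Types A B : E -> F.

Lemma blinD A : blin A -> forall u v, A (u + v) = A u + A v.
Proof. by case. Qed.
Lemma blinZ A : blin A -> forall a u, A (a *: u) = a *: A u.
Proof. by case=> _ []. Qed.
Lemma blin0 A : blin A -> A 0 = 0.
Proof. by move=> hA; rewrite -(scale0r 0) blinZ// scale0r. Qed.
Lemma blinN A : blin A -> forall u, A (- u) = - A u.
Proof. by move=> hA u; rewrite -scaleN1r blinZ// scaleN1r. Qed.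
Lemma blinB A : blin A -> forall u v, A (u - v) = A u - A v.
Proof. by move=> hA u v; rewrite blinD// blinN. Qed.
Lemma blin_sum A (I : Type) (r : seq I) (P : pred I) (u : I -> E) : blin A ->
  A (\sum_(i <- r | P i) u i) = \sum_(i <- r | P i) A (u i).
Proof.
move=> hA; apply: (big_ind2 (fun x y => A x = y)) => //; first exact: blin0.
by move=> x1 x2 y1 y2 <- <-; rewrite blinD.
Qed.
Lemma blin_bound A : blin A -> exists2 K : R, 0 < K & forall v, `|A v| <= K * `|v|.
Proof.
move=> [_ [_ [K K0 hK]]]; exists (K + 1); first by rewrite ltr_wpDl.
by move=> v; apply: (le_trans (hK v)); apply: ler_wpM2r => //; lra.
Qed.

Lemma blin_zero : blin (fun _ : E => 0 : F).
Proof.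
split; first by move=> *; rewrite addr0.
split; first by move=> *; rewrite scaler0.
by exists 0 => // v; rewrite normr0 mul0r.
Qed.
Lemma blin_add A B : blin A -> blin B -> blin (fun v => A v + B v).
Proof.
move=> hA hB; split; first by move=> u v; rewrite !blinD// addrACA.
split; first by move=> a u; rewrite !blinZ// scalerDr.
have [K K0 hK] := blin_bound hA; have [L L0 hL] := blin_bound hB.
exists (K + L); first by rewrite addr_ge0// ltW.
by move=> v; rewrite mulrDl; apply: (le_trans (ler_normD _ _)); apply: lerD.
Qed.
Lemma blin_scale A (c : R) : blin A -> blin (fun v => c *: A v).
Proof.
move=> hA; split; first by move=> u v; rewrite !blinD// scalerDr.
split; first by move=> a u; rewrite !blinZ// !scalerA mulrC.
have [K K0 hK] := blin_bound hA.
exists (`|c| * K); first by rewrite mulr_ge0// ltW.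
by move=> v; rewrite normrZ -mulrA ler_wpM2l.
Qed.
Lemma blin_opp A : blin A -> blin (fun v => - A v).
Proof.
by move=> hA; under eq_fun do rewrite -scaleN1r; apply: blin_scale.
Qed.
Lemma blin_sub A B : blin A -> blin B -> blin (fun v => A v - B v).
Proof. by move=> hA hB; apply: blin_add => //; apply: blin_opp. Qed.
Lemma blin_bigsum (I : Type) (r : seq I) (P : pred I) (A : I -> E -> F) :
  (forall i, P i -> blin (A i)) -> blin (fun v => \sum_(i <- r | P i) A i v).
Proof.
move=> hA; elim: r => [|i r IH].
  by under eq_fun do rewrite big_nil; exact: blin_zero.
under eq_fun do rewrite big_cons; case: (boolP (P i)) => // Pi.
by apply: blin_add => //; exact: hA.
Qed.
End Blin.

Lemma blin_id (E : normedModType R) : blin (@id E).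
Proof. by split=> //; split=> //; exists 1 => // v; rewrite mul1r. Qed.
Lemma blin_comp (E F G : normedModType R) (A : E -> F) (B : F -> G) :
  blin A -> blin B -> blin (fun v => B (A v)).
Proof.
move=> hA hB; split; first by move=> u v; rewrite !blinD.
split; first by move=> a u; rewrite !blinZ.
have [K K0 hK] := blin_bound hA; have [L L0 hL] := blin_bound hB.
exists (L * K); first by rewrite mulr_ge0// ltW.
by move=> v; apply: (le_trans (hL _)); rewrite -mulrA ler_wpM2l// ltW.
Qed.
Lemma blin_mul (E : normedModType R) (A : E -> R) (c : R) : blin A -> blin (fun v => c * A v).
Proof. exact: blin_scale. Qed.
Lemma blin_mulr (E : normedModType R) (A : E -> R) (c : R) : blin A -> blin (fun v => A v * c).
Proof. by move=> hA; under eq_fun do rewrite mulrC; exact: blin_mul. Qed.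
Lemma blin_vec (E : normedModType R) (c : E) : blin (fun t : R => t *: c).
Proof.
split; first by move=> u v; rewrite scalerDl.
split; first by move=> a u; rewrite scalerA.
by exists `|c| => // v; rewrite normrZ mulrC.
Qed.
Lemma blinZr (E : normedModType R) (A : E -> R) : blin A -> forall a u, A (a *: u) = a * A u.
Proof. exact: blinZ. Qed.

End BoundedLinear.

Section StrictDerivative.
Variable R : realType.

(* Strict differentiability at [x]: on an open set it is equivalent to being C^1, but it is a
   pointwise condition, stable under composition and uniformly convergent series. *)
Definition sder (E F : normedModType R) (f : E -> F) (x : E) (A : E -> F) : Prop :=
  blin A /\ forall e : R, 0 < e -> exists2 V : set E, nbhs x V &
    forall y z, V y -> V z -> `|f y - f z - A (y - z)| <= e * `|y - z|.

Section Basic.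
Variables E F : normedModType R.
Implicit Types (f g : E -> F) (x : E) (A B : E -> F).

Lemma nbhs_ballr x (dl : R) : 0 < dl -> nbhs x [set y | `|y - x| < dl].
Proof.
move=> dl0; apply/nbhs_ballP; exists dl => //= y.
by rewrite -ball_normE /= distrC.
Qed.
Lemma nbhs_exr x (V : set E) : nbhs x V -> exists2 dl : R, 0 < dl & forall y, `|y - x| < dl -> V y.
Proof.
move=> /nbhs_ballP[dl /= dl0 h]; exists dl => // y hy; apply: h.
by rewrite -ball_normE /= distrC.
Qed.

Lemma sder_blin f x A : sder f x A -> blin A.
Proof. by case. Qed.

Lemma sder_lip f x A : sder f x A -> exists2 K : R, 0 < K & exists2 V : set E, nbhs x V &
  forall y z, V y -> V z -> `|f y - f z| <= K * `|y - z|.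
Proof.
move=> [hA h]; have [K K0 hK] := blin_bound hA; have [V hV hf] := h 1 ltr01.
exists (K + 1); first by lra.
exists V => // y z Vy Vz; rewrite -[f y - f z](subrK (A (y - z))).
rewrite (le_trans (ler_normD _ _))// mulrDl addrC.
by apply: lerD; [exact: hK | exact: hf].
Qed.

Lemma lip_near_cont f x (K : R) (V : set E) : nbhs x V ->
  (forall y, V y -> `|f y - f x| <= K * `|y - x|) -> {for x, continuous f}.
Proof.
move=> hV h; apply/cvgrPdist_le => /= e e0.
near=> y; rewrite distrC; apply: (le_trans (h y _)); first by near: y.
have : `|y - x| < e / (`|K| + 1).
  by near: y; apply: nbhs_ballr; rewrite divr_gt0// ltr_wpDl.
rewrite ltr_pdivlMr ?ltr_wpDl// => h1; apply/ltW; apply: le_lt_trans h1.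
by rewrite mulrC; apply: ler_wpM2l => //; rewrite (le_trans (ler_norm K))//; lra.
Unshelve. all: by end_near. Qed.

Lemma sder_cont f x A : sder f x A -> {for x, continuous f}.
Proof.
move=> /sder_lip[K K0 [V hV h]]; apply: (lip_near_cont hV (K := K)) => y Vy.
by apply: h => //; exact: nbhs_singleton.
Qed.

Lemma blin_cont A : blin A -> continuous A.
Proof.
move=> hA x; have [K K0 hK] := blin_bound hA.
by apply: (lip_near_cont filterT (K := K)) => y _; rewrite -(blinB hA).
Qed.

Lemma sder_near f g x A : sder f x A -> (exists2 V, nbhs x V & forall y, V y -> f y = g y) ->
  sder g x A.
Proof.
move=> [hA h] [V hV fg]; split => // e e0; have [W hW hf] := h e e0.
exists (V `&` W); first exact: filterI.
by move=> y z [Vy Wy] [Vz Wz]; rewrite -!fg//; exact: hf.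
Qed.

Lemma sder_eqd f x A B : sder f x A -> (forall v, A v = B v) -> sder f x B.
Proof. by move=> h /funext <-. Qed.

Lemma sder_cst (c : F) x : sder (fun _ => c) x (fun _ => 0).
Proof.
split; first exact: blin_zero.
move=> e e0; exists setT; first exact: filterT.
by move=> y z _ _ /=; rewrite subrr sub0r normrN normr0 mulr_ge0// ltW.
Qed.

Lemma sder_lin A x : blin A -> sder A x A.
Proof.
move=> hA; split => // e e0; exists setT; first exact: filterT.
by move=> y z _ _; rewrite (blinB hA) subrr normr0 mulr_ge0// ltW.
Qed.

Lemma sder_add f g x A B : sder f x A -> sder g x B ->
  sder (fun y => f y + g y) x (fun v => A v + B v).
Proof.
move=> [hA hf] [hB hg]; split; first exact: blin_add.
move=> e e0; have e2 : 0 < e / 2 by lra.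
have [V hV h1] := hf _ e2; have [W hW h2] := hg _ e2.
exists (V `&` W); first exact: filterI.
move=> y z [Vy Wy] [Vz Wz].
have -> : f y + g y - (f z + g z) - (A (y - z) + B (y - z)) =
  (f y - f z - A (y - z)) + (g y - g z - B (y - z)).
  by rewrite !opprD (addrACA (f y)) (addrACA (f y - f z)).
rewrite (le_trans (ler_normD _ _))// [e]splitr mulrDl.
by apply: lerD; [exact: h1|exact: h2].
Qed.

Lemma sder_sum (I : Type) (r : seq I) (f : I -> E -> F) x (A : I -> E -> F) :
  (forall i, sder (f i) x (A i)) ->
  sder (fun y => \sum_(i <- r) f i y) x (fun v => \sum_(i <- r) A i v).
Proof.
move=> h; elim: r => [|i r IH].
  under eq_fun do rewrite big_nil; under [X in sder _ _ X]eq_fun do rewrite big_nil.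
  exact: sder_cst.
under eq_fun do rewrite big_cons; under [X in sder _ _ X]eq_fun do rewrite big_cons.
exact: sder_add.
Qed.

(** One increment along [v], scaled by a small [t] to stay in the neighbourhood, bounds [A v] up to
    [e] times the norm of [v], and [e] is arbitrary. Only increments based at [x] are compared. *)
Lemma sder_bound f x A (K : R) : sder f x A ->
  (exists2 V, nbhs x V & forall y, V y -> `|f y - f x| <= K * `|y - x|) ->
  forall v, `|A v| <= K * `|v|.
Proof.
move=> [hA h] [V hV hK] v; have [->|v0] := eqVneq v 0.
  by rewrite (blin0 hA) !normr0 mulr0.
have nv : 0 < `|v| by rewrite normr_gt0.
rewrite -ler_pdivrMr//; apply/ler_addgt0Pl => e e0; rewrite ler_pdivrMr//.
have [W hW hf] := h e e0.
have [dl dl0 hd] := nbhs_exr (filterI hV hW).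
pose t := dl / (2 * `|v|).
have t0 : 0 < t by rewrite divr_gt0// mulr_gt0.
have hy : `|(x + t *: v) - x| < dl.
  rewrite addrC addKr normrZ gtr0_norm// /t invfM -!mulrA mulVf ?gt_eqF// mulr1; lra.
have [Vy Wy] := hd _ hy.
have := hf _ _ Wy (nbhs_singleton hW); have := hK _ Vy.
rewrite [x + _]addrC addrK (blinZ hA) normrZ gtr0_norm// => h1 h2.
have : `|t *: A v| <= (e + K) * (t * `|v|).
  rewrite -[t *: A v](subKr (f (t *: v + x) - f x)).
  by rewrite (le_trans (ler_normB _ _))// mulrDl addrC lerD.
by rewrite normrZ gtr0_norm// mulrCA ler_pM2l.
Qed.

(** On [V] the map [f - A] has Lipschitz constant [e], and its derivative at [y] is [B - A]. In this
    way continuity of the derivative is read off from the pointwise condition at [x]. *)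
Lemma sder_derclose f x A (e : R) : sder f x A -> 0 < e ->
  exists2 V, nbhs x V & forall y B, V y -> sder f y B -> forall v, `|B v - A v| <= e * `|v|.
Proof.
move=> [hA h] e0; have [V hV hf] := h _ e0.
exists V^°; first exact: nbhs_interior.
move=> y B Vy hB; have hAB : sder (fun z => f z + - A z) y (fun v => B v + - A v).
  by apply: sder_add => //; apply: sder_lin; exact: blin_opp.
apply: (sder_bound hAB); exists V => // z Vz.
have -> : f z + - A z - (f y + - A y) = f z - f y - A (z - y).
  by rewrite (blinB hA) !opprD addrACA.
by apply: hf => //; exact: interior_subset Vy.
Qed.

Lemma sder_diff f x A : sder f x A -> differentiable f x /\ 'd f x = A :> (E -> F).
Proof.
move=> h; have hA := sder_blin h.
have lA : linear A by move=> a u v; rewrite (blinD hA) blinZ.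
pose AL := GRing.isLinear.Build _ _ _ _ A lA.
pose A' : {linear E -> F} := HB.pack A AL.
have cA : continuous A' by exact: blin_cont.
have eq : f \o shift x = cst (f x) + A' +o_ 0 id.
  apply/eqaddoP => _/posnumP[ep].
  have [V hV hf] := h.2 ep%:num [gt0 of ep%:num].
  have [dl dl0 hd] := nbhs_exr hV.
  near=> v.
  have -> : (f \o shift x - (cst (f x) + A')) v = f (v + x) - f x - A (v + x - x).
    by rewrite addrK -addrA -opprD.
  have -> : `|v| = `|v + x - x| by rewrite addrK.
  apply: hf; last exact: nbhs_singleton.
  apply: hd; rewrite addrK; near: v; have := nbhs_ballr (0 : E) dl0.
  by apply: filterS => v /=; rewrite subr0.
have dA := diff_unique cA eq.
split; last by rewrite dA.
by apply/diff_locallyP; rewrite dA.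
Unshelve. all: by end_near. Qed.

End Basic.

Lemma sder_comp (E F G : normedModType R) (f : E -> F) (g : F -> G) x A B :
  sder f x A -> sder g (f x) B -> sder (fun y => g (f y)) x (fun v => B (A v)).
Proof.
move=> hf hg; split; first by apply: blin_comp; [exact: sder_blin hf|exact: sder_blin hg].
move=> e e0; have [K K0 [V hV hK]] := sder_lip hf.
have hB := sder_blin hg; have [L L0 hL] := blin_bound hB.
have e1 : 0 < e / 2 / K by rewrite !divr_gt0.
have e2 : 0 < e / 2 / L by rewrite !divr_gt0.
have [W hW h1] := hg.2 _ e1; have [X hX h2] := hf.2 _ e2.
exists (V `&` (f @^-1` W) `&` X).
  by apply: filterI => //; apply: filterI => //; exact: (sder_cont hf).
move=> y z [[Vy Wy] Xy] [[Vz Wz] Xz].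
have -> : g (f y) - g (f z) - B (A (y - z)) =
  (g (f y) - g (f z) - B (f y - f z)) + B (f y - f z - A (y - z)).
  by rewrite (blinB hB (f y - f z)) addrA subrK.
rewrite (le_trans (ler_normD _ _))// [e]splitr mulrDl; apply: lerD.
  rewrite (le_trans (h1 _ _ Wy Wz))//.
  have -> : e / 2 * `|y - z| = e / 2 / K * (K * `|y - z|) by rewrite mulrA divfK// gt_eqF.
  by apply: ler_wpM2l; [exact: ltW | exact: hK].
rewrite (le_trans (hL _))//.
have -> : e / 2 * `|y - z| = L * (e / 2 / L * `|y - z|) by rewrite mulrA [L * _]mulrC divfK// gt_eqF.
by apply: ler_wpM2l; [exact: ltW|exact: h2].
Qed.

Lemma sder_mul (E : normedModType R) (f g : E -> R) x A B :
  sder f x A -> sder g x B -> sder (fun y => f y * g y) x (fun v => A v * g x + f x * B v).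
Proof.
move=> hf hg; split.
  apply: blin_add; first by apply: blin_mulr; exact: sder_blin hf.
  by apply: blin_mul; exact: sder_blin hg.
move=> e e0.
have [K K0 [V hV hK]] := sder_lip hf; have [L L0 [W hW hL]] := sder_lip hg.
pose C := `|f x| + `|g x| + K + L + 1.
have C0 : 0 < C by rewrite /C; have := normr_ge0 (f x); have := normr_ge0 (g x); lra.
have e1 : 0 < e / C / 4 by rewrite !divr_gt0.
have [V1 hV1 h1] := hf.2 _ e1; have [W1 hW1 h2] := hg.2 _ e1.
have cf : nbhs x [set y | `|f x - f y| <= e / C / 4].
  by have /cvgrPdist_le := sder_cont hf; apply.
have cg : nbhs x [set y | `|g x - g y| <= e / C / 4].
  by have /cvgrPdist_le := sder_cont hg; apply.
exists (V `&` W `&` (V1 `&` W1) `&` ([set y | `|f x - f y| <= e / C / 4] `&`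
   [set y | `|g x - g y| <= e / C / 4])).
  by do !apply: filterI.
move=> y z [[[Vy Wy] [V1y W1y]] [fy gy]] [[[Vz Wz] [V1z W1z]] [fz gz]].
rewrite /= in fy gy fz gz.
have -> : f y * g y - f z * g z - (A (y - z) * g x + f x * B (y - z)) =
  (f y - f x) * (g y - g z) + f x * (g y - g z - B (y - z)) +
  ((f y - f z) * (g z - g x) + (f y - f z - A (y - z)) * g x) by ring.
pose q := e / C / 4 * `|y - z|.
have q0 : 0 <= q by rewrite mulr_ge0// ltW.
have -> : e * `|y - z| = C * q + C * q + (C * q + C * q).
  by rewrite /q; field; rewrite gt_eqF.
have aux (a b c : R) : `|a| <= e / C / 4 -> 0 < c -> c <= C -> `|b| <= c * `|y - z| -> `|a * b| <= C * q.
  move=> ha c0 cC hb; rewrite normrM.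
  apply: (le_trans (ler_pM _ _ ha hb)) => //.
  by rewrite mulrCA; apply: ler_wpM2r.
have nf := normr_ge0 (f x); have ng := normr_ge0 (g x).
have aux2 (a b : R) : `|a| <= C -> `|b| <= q -> `|a * b| <= C * q.
  by move=> ha hb; rewrite normrM; apply: ler_pM.
do 2 (apply: (le_trans (ler_normD _ _)); apply: lerD).
- by apply: (aux _ _ L) => //; [rewrite distrC|rewrite /C; lra|exact: hL].
- by apply: aux2; [rewrite /C; lra|exact: h2].
- by rewrite mulrC; apply: (aux _ _ K) => //; [rewrite distrC|rewrite /C; lra|exact: hK].
- by rewrite mulrC; apply: aux2; [rewrite /C; lra|exact: h1].
Qed.

End StrictDerivative.

Section Calculus.
Variable R : realType.

(** * Row vectors and the comparison of the Euclidean and sup norms *)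

Section RowVectors.
Variable d : nat.
Implicit Types w : 'rV[R]_d.

Lemma rV_norm_le w (c : R) : 0 <= c -> (forall i, `|w ord0 i| <= c) -> `|w| <= c.
Proof.
move=> c0 h; rewrite [`|w|]mx_normrE; apply: bigmax_le => // -[i j] _ /=.
by rewrite (ord1 i).
Qed.

Lemma rV_coord_le w i : `|w ord0 i| <= `|w|.
Proof.
by rewrite [`|w|]mx_normrE; apply: (le_bigmax _ (fun ij => `|w ij.1 ij.2|) (ord0, i)).
Qed.

Lemma eucl_ge0 w : 0 <= eucl w.
Proof. exact: sqrtr_ge0. Qed.

(* [`|w|] is the sup norm on row vectors. *)
Lemma norm_le_eucl w : `|w| <= eucl w.
Proof.
apply: rV_norm_le; first exact: eucl_ge0.
move=> i; rewrite -sqrtr_sqr; apply: ler_wsqrtr.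
rewrite (bigD1 i)//= lerDl; apply: sumr_ge0 => j _; exact: sqr_ge0.
Qed.

Lemma eucl_le_norm w : eucl w <= d.+1%:R * `|w|.
Proof.
have h0 : 0 <= d.+1%:R * `|w| by rewrite mulr_ge0.
rewrite -(ger0_norm h0) -sqrtr_sqr; apply: ler_wsqrtr.
apply: (@le_trans _ _ (\sum_(i < d) `|w| ^+ 2)).
  apply: ler_sum => i _; rewrite -(real_normK (num_real (w ord0 i))).
  by rewrite lerXn2r ?nnegrE//; exact: rV_coord_le.
rewrite sumr_const card_ord exprMn -[X in X <= _]mulr_natl; apply: ler_wpM2r.
  exact: sqr_ge0.
by rewrite -natrX ler_nat (leq_trans (leqnSn d))// -{1}(expn1 d.+1) leq_pexp2l.
Qed.

Lemma blin_row (E : normedModType R) (A : 'I_d -> E -> R) :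
  (forall i, blin (A i)) -> blin (fun v => \row_i A i v).
Proof.
move=> hA; split; first by move=> u v; apply/rowP => i; rewrite !mxE (blinD (hA i)).
split; first by move=> a u; apply/rowP => i; rewrite !mxE (blinZr (hA i)).
have /choice[K hK] : forall i, exists K : R, 0 < K /\ forall v, `|A i v| <= K * `|v|.
  by move=> i; have [K K0 h] := blin_bound (hA i); exists K.
exists (\sum_i K i); first by apply: sumr_ge0 => i _; have [/ltW] := hK i.
move=> v; apply: rV_norm_le.
  by rewrite mulr_ge0//; apply: sumr_ge0 => i _; have [/ltW] := hK i.
move=> i; rewrite mxE; have [_ /(_ v) h] := hK i; apply: (le_trans h).
apply: ler_wpM2r => //; rewrite (bigD1 i)//= lerDl; apply: sumr_ge0 => j _.
by have [/ltW] := hK j.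
Qed.

Lemma sder_row (E : normedModType R) (f : 'I_d -> E -> R) x (A : 'I_d -> E -> R) :
  (forall i, sder (f i) x (A i)) -> sder (fun y => \row_i f i y) x (fun v => \row_i A i v).
Proof.
move=> h; split; first by apply: blin_row => i; exact: sder_blin (h i).
move=> e e0.
have /choice[V hV] : forall i, exists V : set E, nbhs x V /\
    forall y z, V y -> V z -> `|f i y - f i z - A i (y - z)| <= e * `|y - z|.
  by move=> i; have [V ? ?] := (h i).2 e e0; exists V.
exists [set y | forall i, V i y].
  have : \forall y \near x, forall i, i \in enum 'I_d -> V i y.
    elim: (enum _) => [|i s IH]; first by near=> y.
    near=> y => j; rewrite inE => /orP[/eqP->|].
      by near: y; have [] := hV i.
    by move: j; near: y.
  by apply: filterS => y hy i; apply: hy; rewrite mem_enum.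
move=> y z Vy Vz; apply: rV_norm_le; first by rewrite mulr_ge0// ltW.
by move=> i; rewrite !mxE; have [_] := hV i; apply.
Unshelve. all: by end_near. Qed.

Lemma blin_coord (i : 'I_d) : blin (fun w : 'rV[R]_d => w ord0 i).
Proof.
split; first by move=> u v; rewrite mxE.
split; first by move=> a v; rewrite mxE.
by exists 1 => // v; rewrite mul1r; exact: rV_coord_le.
Qed.

End RowVectors.

(** * One-variable functions: the squared positive part and the inverse *)

Definition ppos (u : R) : R := Num.max u 0.
(** Squaring makes the positive part C^1; the cut-offs and bumps below are built from this
    function. *)
Definition psq (u : R) : R := (ppos u) ^+ 2.

Lemma ppos_ge0 u : 0 <= ppos u.
Proof. by rewrite le_max lexx orbT. Qed.
Lemma pposE u : (0 <= u /\ ppos u = u) \/ (u < 0 /\ ppos u = 0).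
Proof. by rewrite /ppos; case: leP => h; [left|right]; rewrite ?h. Qed.
Lemma ppos_lip u v : `|ppos u - ppos v| <= `|u - v|.
Proof.
case: (pposE u) (pposE v) => [[hu ->]|[hu ->]] [[hv ->]|[hv ->]].
- by [].
- by rewrite subr0 !ger0_norm; lra.
- by rewrite ler0_norm ?ler0_norm; lra.
- by rewrite subrr normr0.
Qed.
Lemma psq_ge0 u : 0 <= psq u. Proof. exact: sqr_ge0. Qed.
(** Convexity of [psq] accounts for the lower bound. The upper bound is the second-order remainder,
    since the slope [2 * ppos] is 2-Lipschitz. *)
Lemma psq_expand u v : 0 <= psq u - psq v - 2 * ppos v * (u - v) <= (u - v) ^+ 2.
Proof.
rewrite /psq; have := sqr_ge0 u; have := sqr_ge0 v; have := sqr_ge0 (u - v).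
rewrite !expr2.
case: (pposE u) (pposE v) => [[hu ->]|[hu ->]] [[hv ->]|[hv ->]] h1 h2 h3;
  apply/andP; split; try lra.
- by have := mulr_ge0 hu (ltW (_ : 0 < - v)); rewrite oppr_gt0 => /(_ hv); lra.
- by have := mulr_ge0 hv (ltW (_ : 0 < - u)); rewrite oppr_gt0 => /(_ hu); lra.
Qed.

Lemma sder_psq x : sder psq x (fun h => 2 * ppos x * h).
Proof.
split; first exact: (blin_mul (2 * ppos x) (blin_id R)).
move=> e e0; have e4 : 0 < e / 4 by lra.
exists [set y | `|y - x| < e / 4]; first exact: nbhs_ballr.
move=> y z /= hy hz.
have -> : psq y - psq z - 2 * ppos x * (y - z) =
  (psq y - psq z - 2 * ppos z * (y - z)) + 2 * (ppos z - ppos x) * (y - z) by ring.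
have yz : `|y - z| <= e / 2.
  have := ler_distD x y z; rewrite (distrC x z); lra.
have := psq_expand y z => /andP[h1 h2].
apply: (le_trans (ler_normD _ _)); rewrite (ger0_norm h1).
have h3 : `|2 * (ppos z - ppos x) * (y - z)| <= e / 2 * `|y - z|.
  rewrite normrM; apply: ler_wpM2r => //; rewrite normrM ger0_norm//.
  have := ppos_lip z x; lra.
have h4 : (y - z) ^+ 2 <= e / 2 * `|y - z|.
  by rewrite -(real_normK (num_real (y - z))) expr2 ler_wpM2r.
lra.
Qed.

Lemma sder_inv (x : R) : x != 0 -> sder (fun y : R => y^-1) x (fun h : R => - x ^- 2 * h).
Proof.
move=> x0; split; first exact: (blin_mul (- x ^- 2) (blin_id R)).
move=> e e0; pose C := 2 * `|x^-1| + 1.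
have C0 : 0 < C by rewrite /C; have := normr_ge0 x^-1; lra.
pose e1 := Num.min 1 (e / C).
have e10 : 0 < e1 by rewrite lt_min ltr01 divr_gt0.
have ceV : nbhs x [set y : R | `|x^-1 - y^-1| <= e1].
  have h : {for x, continuous (fun y : R => y^-1)} by exact: inv_continuous.
  by have /cvgrPdist_le := h; apply.
have cne : nbhs x [set y : R | y != 0].
  have x00 : 0 < `|x| by rewrite normr_gt0.
  apply: filterS (nbhs_ballr x x00) => y /=; apply: contraTneq => ->.
  by rewrite sub0r normrN ltxx.
exists ([set y | `|x^-1 - y^-1| <= e1] `&` [set y | y != 0]); first exact: filterI.
move=> y z [/= hy y0] [/= hz z0].
(* Each summand of this factorization contains a difference of inverses that is at most [e1]; the
   other factors add up to at most [C]. *)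
have -> : y^-1 - z^-1 - - x ^- 2 * (y - z) =
  (x^-1 * (x^-1 - y^-1) + y^-1 * (x^-1 - z^-1)) * (y - z).
  by field; rewrite x0 y0 z0.
rewrite normrM; apply: ler_wpM2r => //; apply: (le_trans (ler_normD _ _)).
have yb : `|y^-1| <= `|x^-1| + e1.
  by rewrite -[y^-1](subKr x^-1) (le_trans (ler_normB _ _))// lerD2l.
have e11 : e1 <= 1 by rewrite ge_min lexx.
have : e1 * C <= e by rewrite -ler_pdivlMr// ge_min lexx orbT.
rewrite !normrM /C => hC.
have h1 : `|x^-1| * `|x^-1 - y^-1| <= `|x^-1| * e1 by apply: ler_wpM2l.
have h2 : `|y^-1| * `|x^-1 - z^-1| <= (`|x^-1| + 1) * e1.
  by apply: ler_pM => //; lra.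
lra.
Qed.

Lemma diff_blin (E F : normedModType R) (f : E -> F) x : differentiable f x -> blin ('d f x).
Proof.
move=> df; split; first by move=> u v; rewrite linearD.
split; first by move=> a u; rewrite linearZ.
have := diff_continuous df => /linear_bounded_continuous/linear_boundedP h.
near +oo_R => K; exists K; first by near: K; apply: nbhs_pinfty_ge.
by near: K.
Unshelve. all: by end_near. Qed.

(** * Operator norms, C^1 maps and strict derivatives *)

Section Opnorm.
Variables (E F : normedModType R) (nF : F -> R) (C : R).
Hypothesis C0 : 0 < C.
Hypothesis nFle : forall w, nF w <= C * `|w|.
Hypothesis lenF : forall w, `|w| <= C * nF w.

Lemma opnorm_le (L : E -> F) (b : R) : (forall v, `|v| <= 1 -> nF (L v) <= b) ->
  opnorm nF L <= b.
Proof.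
move=> h; apply: ge_sup; last by move=> _ [v /= hv <-]; exact: h.
by exists (nF (L 0)); exists 0 => //=; rewrite normr0.
Qed.

Lemma le_opnorm (L : E -> F) : blin L -> forall v, `|L v| <= C * opnorm nF L * `|v|.
Proof.
move=> hL v; have [->|v0] := eqVneq v 0; first by rewrite blin0// !normr0 mulr0.
have nv : 0 < `|v| by rewrite normr_gt0.
have [K K0 hK] := blin_bound hL.
pose u := `|v|^-1 *: v.
have nu : `|u| <= 1 by rewrite normrZ gtr0_norm ?invr_gt0// mulVf// gt_eqF.
have h : nF (L u) <= opnorm nF L.
  apply: ub_le_sup; last by exists u.
  exists (C * K) => _ [w /= hw <-]; apply: (le_trans (nFle _)).
  rewrite ler_pM2l//; apply: (le_trans (hK _)).
  by rewrite -[leRHS]mulr1 ler_pM2l.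
have : `|L u| <= C * opnorm nF L by apply: (le_trans (lenF _)); rewrite ler_pM2l.
by rewrite /u blinZ// normrZ gtr0_norm ?invr_gt0// mulrC ler_pdivrMr.
Qed.

Lemma sder_C1_on (U : set E) (f : E -> F) :
  (forall x, U x -> exists A, sder f x A) -> C1_on nF U f.
Proof.
move=> h; split; first by move=> x /h[A /sder_diff[]].
move=> x Ux eps eps0; have [A hA] := h x Ux.
have e1 : 0 < eps / 2 / C by rewrite !divr_gt0.
have [V /nbhs_exr[dl dl0 hd] hV] := sder_derclose hA e1.
exists dl => // y Uy hy; have [B hB] := h y Uy.
apply: (@le_lt_trans _ _ (eps / 2)); last lra.
apply: opnorm_le => v v1; apply: (le_trans (nFle _)).
have [_ ->] := sder_diff hA; have [_ ->] := sder_diff hB.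
have := hV y B (hd _ hy) hB v => h1.
rewrite mulrC -ler_pdivlMr//; apply: (le_trans h1).
by rewrite -[leRHS]mulr1 ler_pM2l.
Qed.

Lemma C1_on_near (U : set E) (f : E -> F) x e : open U -> C1_on nF U f -> U x -> 0 < e ->
  exists2 V, nbhs x V & forall y, V y -> differentiable f y /\
    forall v, `|'d f y v - 'd f x v| <= e * `|v|.
Proof.
move=> oU [df hf] Ux e0; have e1 : 0 < e / C by rewrite divr_gt0.
have [dl dl0 h] := hf x Ux _ e1.
exists (U `&` [set y | `|y - x| < dl]).
  by apply: filterI; [exact: open_nbhs_nbhs | exact: nbhs_ballr].
move=> y [Uy /= hy]; split; first exact: df.
move=> v; have bl : blin (fun v => 'd f y v - 'd f x v).
  by apply: blin_sub; apply: diff_blin; exact: df.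
apply: (le_trans (le_opnorm bl v)); apply: ler_wpM2r => //.
by rewrite mulrC -ler_pdivlMr//; apply/ltW/h.
Qed.
End Opnorm.

(** The mean value theorem along the segment from [z] to [y], which stays in the ball by convexity,
    turns closeness of the derivatives into the two-point estimate. *)
Lemma diff_near_sder1 (E : normedModType R) (f : E -> R) x :
  (forall e, 0 < e -> exists2 V, nbhs x V & forall y, V y -> differentiable f y /\
    forall v, `|'d f y v - 'd f x v| <= e * `|v|) ->
  sder f x ('d f x).
Proof.
move=> h; have dx : differentiable f x.
  by have [V hV /(_ x (nbhs_singleton hV))[]] := h 1 ltr01.
split; first exact: diff_blin.
move=> e e0; have [V /nbhs_exr[dl dl0 hd] hV] := h e e0.
exists [set y | `|y - x| < dl]; first exact: nbhs_ballr.
move=> y z /= hy hz.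
pose l (t : R) : E := t *: (y - z) + z.
have sl (t : R) : sder l t (fun s => s *: (y - z) + 0).
  by apply: sder_add; [apply: sder_lin; exact: blin_vec | exact: sder_cst].
have hl (t : R) : 0 <= t <= 1 -> `|l t - x| < dl.
  move=> /andP[t0 t1].
  have -> : l t - x = t *: (y - x) + (1 - t) *: (z - x).
    have Eyz : y - z = (y - x) - (z - x) by rewrite opprB addrA subrK.
    rewrite /l Eyz [t *: (_ - (z - x))]scalerBr scalerBl scale1r -!addrA.
    by congr (_ + _); rewrite addrC !addrA.
  apply: (le_lt_trans (ler_normD _ _)); rewrite !normrZ ger0_norm// ger0_norm ?subr_ge0//.
  have : Num.max `|y - x| `|z - x| < dl by rewrite gt_max hy hz.
  apply: le_lt_trans; set m := Num.max _ _.
  have h1 : t * `|y - x| <= t * m by apply: ler_wpM2l => //; rewrite le_max lexx.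
  have h2 : (1 - t) * `|z - x| <= (1 - t) * m.
    by apply: ler_wpM2l; [lra | rewrite le_max lexx orbT].
  lra.
have dl1 (t : R) : 0 <= t <= 1 -> is_derive t 1 (f \o l) ('d f (l t) (y - z)).
  move=> /hl/hd/hV[df _]; have [dlt El] := sder_diff (sl t).
  have dc : differentiable (f \o l) t by apply: differentiable_comp.
  split; first exact: diff_derivable.
  by rewrite deriveE// diff_comp//= El scale1r addr0.
have [c cI] : exists2 c, c \in `[0, 1]%R & (f \o l) 1 - (f \o l) 0 = 'd f (l c) (y - z) * (1 - 0).
  apply: (@MVT_segment R (f \o l) (fun t => 'd f (l t) (y - z))) => //.
    by move=> t /andP[/= /[!bnd_simp] t0 t1]; apply: dl1; rewrite !ltW.
  apply: derivable_within_continuous => t; rewrite in_itv /= => /dl1[] //.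
rewrite /= /l scale1r subrK scale0r add0r subr0 mulr1 => ->.
by have [|_ h1] := hV (l c) (hd _ (hl _ _)); [move: cI; rewrite in_itv|exact: h1].
Qed.

Lemma C1_on_sder1 (E : normedModType R) (U : set E) (f : E -> R) x : open U ->
  C1_on (fun r : R => `|r|) U f -> U x -> sder f x ('d f x).
Proof.
move=> oU hf Ux; apply: diff_near_sder1 => e e0.
by apply: (@C1_on_near _ _ (fun r : R => `|r|) 1) hf Ux e0 => // w; rewrite mul1r.
Qed.

(** The mean value theorem is an equality only for real values, so each coordinate is treated
    separately and the row is put together again. *)
Lemma C1_on_sder (E : normedModType R) d (U : set E) (f : E -> 'rV[R]_d) x : open U ->
  C1_on (@eucl R d) U f -> U x -> sder f x ('d f x).
Proof.
move=> oU hf Ux.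
have cf e : 0 < e -> exists2 V, nbhs x V & forall y, V y -> differentiable f y /\
    forall v, `|'d f y v - 'd f x v| <= e * `|v|.
  move=> e0; apply: (@C1_on_near _ _ (@eucl R d) d.+1%:R) hf Ux e0 => //.
  - exact: eucl_le_norm.
  - move=> w; apply: (le_trans (norm_le_eucl w)).
    by rewrite ler_peMl ?eucl_ge0// ler1n.
have dco y i : differentiable f y -> differentiable (fun y => f y ord0 i) y /\
    forall v, 'd (fun y => f y ord0 i) y v = 'd f y v ord0 i.
  move=> df; have [dc Ec] := sder_diff (sder_lin (f y) (blin_coord i)).
  have := differentiable_comp df dc; have := diff_comp df dc.
  by rewrite /comp => -> ?; split => // v /=; rewrite Ec.
have dfx : differentiable f x by have [V hV /(_ x (nbhs_singleton hV))[]] := cf 1 ltr01.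
have : sder (fun y => \row_i f y ord0 i) x (fun v => \row_i 'd f x v ord0 i).
  apply: sder_row => i.
  suff H : sder (fun y => f y ord0 i) x ('d (fun y => f y ord0 i) x).
    by apply: (sder_eqd H) => v; exact: (dco x i dfx).2.
  apply: diff_near_sder1 => e e0; have [V hV h] := cf e e0.
  exists V => // y /h[df hy]; have [d1 d2] := dco y i df; split => // v.
  rewrite d2 ((dco x i dfx).2 v); apply: le_trans (hy v).
  by have := rV_coord_le ('d f y v - 'd f x v) i; rewrite !mxE.
move=> hs; apply: sder_eqd; first apply: sder_near hs _.
  by exists setT; [exact: filterT|move=> y _; apply/rowP => i; rewrite mxE].
by move=> v; apply/rowP => i; rewrite mxE.
Qed.

Lemma sder_diff_close (E F : normedModType R) (g : E -> F) x A (L : E -> F) (K : R) :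
  sder g x A -> (forall v, `|L v - A v| <= K * `|v|) -> forall v, `|L v - 'd g x v| <= K * `|v|.
Proof. by move=> /sder_diff[_ ->]. Qed.

End Calculus.

(** * The unconditional basis *)

Section Basis.
Variables (R : realType) (E : completeNormedModType R) (e : nat -> E).
Hypothesis hB : one_suppression_unconditional e.

(** The coefficient sequence is selected by [xget]; for a Schauder basis the default is never
    reached. *)
Definition co (x : E) : nat -> R := xget (fun=> 0) [set a | series_to a e x].
Definition Sn (n : nat) (x : E) : E := \sum_(i < n) co x i *: e i.
Definition Tn (n : nat) (x : E) : E := x - Sn n x.

Lemma co_series x : series_to (co x) e x.
Proof.
rewrite /co; case: xgetP => [a _ //|h]; have [a [ha _]] := hB.1 x.
by case: (h a).
Qed.

Arguments co_series : clear implicits.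

Lemma co_uniq x a : series_to a e x -> co x = a.
Proof.
move=> ha; have [b [hb hu]] := hB.1 x.
by rewrite -(hu _ ha) -(hu _ (co_series x)).
Qed.

Lemma coD x y n : co (x + y) n = co x n + co y n.
Proof.
rewrite (@co_uniq _ (fun n => co x n + co y n))// /series_to.
have -> : (fun N => \sum_(i < N) (co x i + co y i) *: e i) =
   (fun N => \sum_(i < N) co x i *: e i) + (fun N => \sum_(i < N) co y i *: e i).
  apply/funext => N; rewrite fctE -big_split /=.
  by apply: eq_bigr => i _; rewrite scalerDl.
exact: cvgD (co_series x) (co_series y).
Qed.

Lemma coZ a x n : co (a *: x) n = a * co x n.
Proof.
rewrite (@co_uniq _ (fun n => a * co x n))// /series_to.
have -> : (fun N => \sum_(i < N) (a * co x i) *: e i) =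
   a *: (fun N => \sum_(i < N) co x i *: e i).
  apply/funext => N; rewrite fctE scaler_sumr /=.
  by apply: eq_bigr => i _; rewrite scalerA.
exact: cvgZr (co_series x).
Qed.

Lemma co_e j i : co (e j) i = (i == j)%:R.
Proof.
rewrite (@co_uniq _ (fun i => (i == j)%:R))// /series_to.
apply: cvg_near_cst; near=> N.
have jN : (j < N)%N by near: N; exists j.+1.
rewrite (bigD1 (Ordinal jN))//= eqxx scale1r big1 ?addr0// => k kj.
by rewrite -val_eqE /= in kj; rewrite (negbTE kj) scale0r.
Unshelve. all: by end_near. Qed.

Lemma co0 n : co 0 n = 0.
Proof. by rewrite -(scale0r (0 : E)) coZ mul0r. Qed.
Lemma coN x n : co (- x) n = - co x n.
Proof. by rewrite -scaleN1r coZ mulN1r. Qed.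
Lemma coB x y n : co (x - y) n = co x n - co y n.
Proof. by rewrite coD coN. Qed.
Lemma co_sum (I : Type) (r : seq I) (P : pred I) (u : I -> E) n :
  co (\sum_(i <- r | P i) u i) n = \sum_(i <- r | P i) co (u i) n.
Proof.
apply: (big_ind2 (fun x y => co x n = y)) => //; first exact: co0.
by move=> x1 x2 y1 y2 <- <-; rewrite coD.
Qed.

Lemma e_neq0 j : e j != 0.
Proof.
apply/eqP => h; have := co_e j j; rewrite h co0 eqxx => /esym/eqP.
by rewrite oner_eq0.
Qed.

Lemma suppress x j : `|x - co x j *: e j| <= `|x|.
Proof.
apply: (hB.2 x (co x) j) (co_series x) _.
suff -> : (fun k => if k == j then 0 else co x k) = co (x - co x j *: e j).
  exact: co_series.
apply/funext => i; rewrite coB coZ co_e; case: eqP => [->|_].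
  by rewrite mulr1 subrr.
by rewrite mulr0 subr0.
Qed.

(** The term [co x j *: e j] is the difference of [x] and its suppression at [j]. Continuity of the
    coordinate functionals thus comes directly from suppression. *)
Lemma co_bound j x : `|co x j| * `|e j| <= 2 * `|x|.
Proof.
rewrite -normrZ -[co x j *: e j](subKr x) (le_trans (ler_normB _ _))//.
by have := suppress x j; lra.
Qed.

Lemma blin_co j : blin (fun x => co x j).
Proof.
split; first by move=> u v; exact: coD.
split; first by move=> a u; exact: coZ.
have ne : 0 < `|e j| by rewrite normr_gt0 e_neq0.
exists (2 / `|e j|); first by rewrite divr_ge0.
by move=> v; rewrite mulrAC ler_pdivlMr// co_bound.
Qed.

Lemma co_lsum N (s : nat -> R) j : co (\sum_(i < N) s i *: e i) j = if (j < N)%N then s j else 0.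
Proof.
rewrite co_sum; under eq_bigr do rewrite coZ co_e.
case: ifP => jN.
  rewrite (bigD1 (Ordinal jN))//= eqxx mulr1 big1 ?addr0// => k kj.
  by rewrite -val_eqE /= eq_sym in kj; rewrite (negbTE kj) mulr0.
rewrite big1// => i _; case: eqP => [jE|]; last by rewrite mulr0.
by rewrite jE ltn_ord in jN.
Qed.

Lemma co_Sn n x j : co (Sn n x) j = if (j < n)%N then co x j else 0.
Proof. exact: co_lsum. Qed.
Lemma co_Tn n x j : co (Tn n x) j = if (j < n)%N then 0 else co x j.
Proof. by rewrite coB co_Sn; case: ifP => _; rewrite ?subrr ?subr0. Qed.

Lemma blin_Sn n : blin (Sn n).
Proof.
apply: blin_bigsum => i _.
exact: (blin_comp (blin_co i) (blin_vec (e i))).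
Qed.
Lemma blin_Tn n : blin (Tn n).
Proof. by apply: blin_sub; [exact: blin_id|exact: blin_Sn]. Qed.

Lemma Sn0 x : Sn 0 x = 0. Proof. by rewrite /Sn big_ord0. Qed.
Lemma SnS n x : Sn n.+1 x = Sn n x + co x n *: e n.
Proof. by rewrite /Sn big_ord_recr. Qed.
Lemma Tn0 x : Tn 0 x = x. Proof. by rewrite /Tn Sn0 subr0. Qed.
Lemma TnS n x : Tn n.+1 x = Tn n x - co x n *: e n.
Proof. by rewrite /Tn SnS opprD addrA. Qed.
Lemma SnTn n x : Sn n x + Tn n x = x.
Proof. by rewrite /Tn addrC subrK. Qed.

Lemma Sn_Tn n m x : (n <= m)%N -> Sn m (Tn n x) = Sn m x - Sn n x.
Proof.
move=> nm; rewrite /Sn -(subnKC nm) big_split_ord [in RHS]big_split_ord /=.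
rewrite [X in X + _]big1 ?add0r; last by move=> i _; rewrite co_Tn ltn_ord scale0r.
rewrite [RHS]addrC addKr; apply: eq_bigr => i _.
by rewrite co_Tn ltnNge leq_addr.
Qed.
Lemma Tn_Tn n m x : (n <= m)%N -> Tn m (Tn n x) = Tn m x.
Proof. by move=> nm; rewrite {1}/Tn Sn_Tn// /Tn opprB addrA subrK. Qed.

(** Coordinates are damped one at a time: multiplying coordinate [N] by [1 - s N] is a convex
    combination of the current vector and its suppression at [N]. *)
Lemma mult_contr (s : nat -> R) x N : (forall i, 0 <= s i <= 1) ->
  `|x - \sum_(i < N) s i *: (co x i *: e i)| <= `|x|.
Proof.
move=> hs; elim: N => [|N IH]; first by rewrite big_ord0 subr0.
rewrite big_ord_recr /= opprD addrA.
set z := x - _ in IH *; apply: le_trans IH.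
have cz : co z N = co x N.
  rewrite /z coB co_sum big1 ?subr0// => i _.
  by rewrite !coZ co_e gtn_eqF// !mulr0.
clearbody z.
have -> : z - s N *: (co x N *: e N) = (1 - s N) *: z + s N *: (z - co z N *: e N).
  by rewrite cz scalerBl scale1r scalerBr addrA subrK.
have /andP[s0 s1] := hs N.
apply: (le_trans (ler_normD _ _)); rewrite !normrZ ger0_norm ?subr_ge0// (ger0_norm s0).
have h : s N * `|z - co z N *: e N| <= s N * `|z| by apply: ler_wpM2l => //; exact: suppress.
lra.
Qed.

Lemma Tn_contr n x : `|Tn n x| <= `|x|.
Proof.
have := @mult_contr (fun=> 1) x n (fun=> _); rewrite lexx ler01 => /(_ (fun=> isT)).
by under eq_bigr do rewrite scale1r.
Qed.
Lemma Tn_mono n m x : (n <= m)%N -> `|Tn m x| <= `|Tn n x|.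
Proof. by move=> nm; rewrite -(Tn_Tn x nm) Tn_contr. Qed.

Lemma Tn_small x (ep : R) : 0 < ep -> exists N, forall n, (N <= n)%N -> `|Tn n x| < ep.
Proof.
move=> ep0; have /cvgrPdist_lt/(_ ep ep0)[N _ hN] := co_series x.
by exists N => n Nn; exact: hN.
Qed.

Lemma co_eq0 x : (forall i, co x i = 0) -> x = 0.
Proof.
move=> h; apply/eqP; rewrite -normr_le0; apply/ler_addgt0Pl => ep ep0; rewrite addr0.
have [N /(_ N (leqnn N))] := Tn_small x ep0.
rewrite /Tn /Sn big1 ?subr0; first exact: ltW.
by move=> i _; rewrite h scale0r.
Qed.
Lemma co_inj x y : (forall i, co x i = co y i) -> x = y.
Proof.
move=> h; apply/eqP; rewrite -subr_eq0; apply/eqP/co_eq0 => i.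
by rewrite coB h subrr.
Qed.
Lemma Tn_eq0 n x : (forall i, (n <= i)%N -> co x i = 0) -> Tn n x = 0.
Proof.
by move=> h; apply: co_eq0 => i; rewrite co_Tn; case: ltnP => // /h.
Qed.

(** Suppression removes only finitely many coordinates. Hence [Sn n x] is reached by removing the
    block from [n] to [M] and then a tail of norm below [ep]. *)
Lemma Sn_contr n x : `|Sn n x| <= `|x|.
Proof.
apply/ler_addgt0Pl => ep ep0; have [N hN] := Tn_small x ep0.
pose M := maxn N n; have /hN h : (N <= M)%N by rewrite leq_maxl.
have nM : (n <= M)%N by rewrite leq_maxr.
have -> : Sn n x = (x - (Sn M x - Sn n x)) - Tn M x.
  by rewrite /Tn (opprB x) [RHS]addrC addrA subrK subKr.
rewrite (le_trans (ler_normB _ _))// addrC lerD//; first exact: ltW.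
have -> : Sn M x - Sn n x = \sum_(i < M) (if (i < n)%N then 0 else 1 : R) *: (co x i *: e i).
  rewrite /Sn -(subnKC nM) 2!big_split_ord /= [in RHS]big1 ?add0r; last first.
    by move=> i _; rewrite ltn_ord scale0r.
  rewrite [LHS]addrC addKr; apply: eq_bigr => i _.
  by rewrite ltnNge leq_addr scale1r.
by apply: (@mult_contr (fun i => if (i < n)%N then 0 else 1)) => i; case: ifP => _; lra.
Qed.

Lemma mult_contr2 (s : nat -> R) x N : (forall i, 0 <= s i <= 1) ->
  `|\sum_(i < N) s i *: (co x i *: e i)| <= `|x|.
Proof.
move=> hs; apply: le_trans (Sn_contr N x).
have := @mult_contr (fun i => 1 - s i) (Sn N x) N (fun i => _).
have h1 i : 0 <= 1 - s i <= 1 by have := hs i; lra.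
move=> /(_ h1); congr (`|_| <= _).
rewrite {1}/Sn -sumrB; apply: eq_bigr => i _.
by rewrite co_Sn ltn_ord scalerBl scale1r opprB addrC subrK.
Qed.

(** The positive and negative parts of [b / B] are multipliers with values in [0, 1]; each
    contributes one copy of [B], hence the factor 2. *)
Lemma mult_signed (b : nat -> R) (B : R) x n N : 0 <= B ->
  (forall i, (n <= i)%N -> `|b i| <= B) -> (forall i, (i < n)%N -> b i = 0) ->
  `|\sum_(i < N) b i *: (co x i *: e i)| <= 2 * B * `|Tn n x|.
Proof.
move=> B0 hb hb0; have hb' i : `|b i| <= B.
  by have [/hb//|/hb0->] := leqP n i; rewrite normr0.
have [B00|Bn0] := eqVneq B 0.
  rewrite big1 ?normr0 ?mulr_ge0// => i _; have := hb' i.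
  by rewrite B00 normr_le0 => /eqP->; rewrite scale0r.
have Bp : 0 < B by rewrite lt_def Bn0.
pose s (c : R) i := ppos (c * b i) / B.
have hs (c : R) : `|c| = 1 -> forall i, 0 <= s c i <= 1.
  move=> c1 i; rewrite divr_ge0 ?ppos_ge0//= ler_pdivrMr// mul1r.
  have : `|c * b i| <= B by rewrite normrM c1 mul1r.
  by case: (pposE (c * b i)) => [[h ->]|[h ->]] //; rewrite ger0_norm.
have -> : \sum_(i < N) b i *: (co x i *: e i) =
   B *: (\sum_(i < N) s 1 i *: (co (Tn n x) i *: e i)) -
   B *: (\sum_(i < N) s (-1) i *: (co (Tn n x) i *: e i)).
  rewrite -scalerBr -sumrB scaler_sumr; apply: eq_bigr => i _.
  rewrite -scalerBl [RHS]scalerA co_Tn; case: ifP => [/hb0->|_].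
    by rewrite scale0r scale0r scaler0.
  congr (_ *: _); rewrite /s mul1r mulN1r -mulrBl mulrC divfK//.
  by case: (pposE (b i)) (pposE (- b i)) => [[h ->]|[h ->]] [[h' ->]|[h' ->]]; lra.
apply: (le_trans (ler_normB _ _)); rewrite !normrZ (ger0_norm B0).
have h1 := mult_contr2 (Tn n x) N (hs 1 (normr1 _)).
have h2 := @mult_contr2 _ (Tn n x) N (hs (-1) (normrN1 _)).
have := ler_wpM2l B0 h1; have := ler_wpM2l B0 h2; lra.
Qed.

Lemma rat_span_dense x (ep : R) : 0 < ep -> exists s : seq rat,
  `|x - \sum_(i < size s) ratr s`_i *: e i| < ep.
Proof.
move=> ep0; have ep2 : 0 < ep / 2 by lra.
have [N /(_ N (leqnn N)) hN] := Tn_small x ep2.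
suff [s [sN hs]] : exists s : seq rat, size s = N /\
    `|Sn N x - \sum_(i < size s) ratr s`_i *: e i| < ep / 2.
  exists s; rewrite -{1}(SnTn N x) addrAC (le_lt_trans (ler_normD _ _))//; lra.
elim: N {hN} (ep / 2) ep2 => [|N IH] ep1 ep10.
  by exists [::]; split => //; rewrite Sn0 big_ord0 subrr normr0.
have ep12 : 0 < ep1 / 2 by lra.
have [s [sN hs]] := IH _ ep12.
have ne : 0 < `|e N| by rewrite normr_gt0 e_neq0.
have dl0 : 0 < ep1 / 2 / `|e N| by rewrite divr_gt0.
have [q hq] : exists q : rat, `|co x N - ratr q| < ep1 / 2 / `|e N|.
  have lt : co x N < co x N + ep1 / 2 / `|e N| by rewrite ltrDl.
  have [q] := rat_in_itvoo lt.
  by rewrite in_itv /= => /andP[q1 q2]; exists q; rewrite ltr0_norm; lra.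
exists (rcons s q); split; first by rewrite size_rcons sN.
rewrite size_rcons big_ord_recr /= SnS nth_rcons ltnn eqxx sN.
have -> : \sum_(i < N) ratr (rcons s q)`_i *: e i = \sum_(i < size s) ratr s`_i *: e i.
  by rewrite -sN; apply: eq_bigr => i _; rewrite nth_rcons ltn_ord.
rewrite opprD addrACA -scalerBl (le_lt_trans (ler_normD _ _))// [ep1]splitr ltrD//.
by rewrite normrZ -ltr_pdivlMr.
Qed.

End Basis.

(** * Ekeland's principle and the squared norm *)

Section CauchySeq.
Variables (R : realType) (E : completeNormedModType R).

Lemma cauchy_seq_cvg (x : nat -> E) :
  (forall ep : R, 0 < ep -> exists N, forall n, (N <= n)%N -> `|x n - x N| <= ep) ->
  exists l : E, x @ \oo --> l.
Proof.
move=> h; suff h1 : cvgn x by exists (limn x).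
apply/(@cauchy_cvgP E); apply: cauchy_exP => ep ep0.
have ep2 : 0 < ep / 2 by rewrite divr_gt0.
have [N hN] := h _ ep2; exists (x N); exists N => // n /= Nn.
rewrite -ball_normE /= distrC (le_lt_trans (hN n Nn))//.
by rewrite ltr_pdivrMr// ltr_pMr// ltr1n.
Qed.

Lemma norm_lim_le (x : nat -> E) (l a : E) (c : R) : x @ \oo --> l ->
  (exists N, forall n, (N <= n)%N -> `|x n - a| <= c) -> `|l - a| <= c.
Proof.
move=> hx [N hN].
apply/ler_addgt0Pr => ep ep0.
have /cvgrPdist_lt/(_ ep ep0)[M _ hM] := hx.
have h1 := hM (maxn N M) (leq_maxr _ _).
have h2 := hN (maxn N M) (leq_maxl _ _).
rewrite /= in h1.
have -> : l - a = (l - x (maxn N M)) + (x (maxn N M) - a) by rewrite addrA subrK.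
rewrite (le_trans (ler_normD _ _))//; lra.
Qed.

Lemma expr2V_lt (ep : R) : 0 < ep -> exists N, forall n, (N <= n)%N -> (2^-1) ^+ n < ep.
Proof.
move=> ep0; have h : (fun n => (2^-1 : R) ^+ n) @ \oo --> 0.
  by apply: cvg_expr; rewrite ger0_norm ?invr_ge0// invf_lt1// ltr1n.
have /cvgrPdist_lt/(_ ep ep0)[N _ hN] := h; exists N => n Nn.
by have := hN n Nn; rewrite /= sub0r normrN ger0_norm ?exprn_ge0 ?invr_ge0.
Qed.

(* Each step at least halves the gap between [F] and its infimum over the set [S]. *)
Lemma ekeland (F : E -> R) (m ep : R) : continuous F -> (forall x, m <= F x) -> 0 < ep ->
  exists x, forall y, F x <= F y + ep * `|y - x|.
Proof.
move=> cF mF ep0.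
pose S x := [set y | F y + ep * `|y - x| <= F x].
have Sx x : S x x by rewrite /S /= subrr normr0 mulr0 addr0.
pose I x := inf (F @` S x).
have Il x y : S x y -> I x <= F y.
  move=> Sy; apply: ge_inf; last by exists y.
  by exists m => _ [z _ <-].
have /choice[nx hnx] : forall x, exists y, S x y /\ F y - I x <= 2^-1 * (F x - I x).
  move=> x; have [IE|IN] := eqVneq (I x) (F x).
    by exists x; split; [exact: Sx|rewrite IE subrr mulr0].
  have Ix : I x < F x by rewrite lt_neqAle IN Il.
  have d0 : 0 < 2^-1 * (F x - I x) by rewrite mulr_gt0 ?invr_gt0// subr_gt0.
  have hi : has_inf (F @` S x).
    by split; [exists (F x); exists x|exists m => _ [z _ <-]].
  have [_ [y Sy <-] hy] := inf_adherent d0 hi.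
  by exists y; split => //; rewrite lerBlDr addrC ltW.
have Strans x y z : S x y -> S y z -> S x z.
  rewrite /S /= => h1 h2; apply: le_trans h1; rewrite -lerBrDr.
  have := ler_distD y z x => h3.
  have : ep * `|z - x| <= ep * (`|z - y| + `|y - x|) by rewrite ler_pM2l.
  rewrite mulrDr; lra.
have D x y : S x y -> ep * `|y - x| <= F x - I x.
  by move=> Sy; have := Il x y Sy; move: Sy; rewrite /S /=; lra.
have le_I x y : S x y -> I x <= I y.
  move=> Sxy; apply: lb_le_inf; first by exists (F y); exists y.
  by move=> _ [z Sz <-]; apply: Il; exact: Strans Sz.
have [x0] : exists x0 : E, True by exists 0.
move=> _; pose u n := iter n nx x0.
have Du n : F (u n) - I (u n) <= (2^-1) ^+ n * (F x0 - I x0).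
  elim: n => [|n IH]; first by rewrite expr0 mul1r.
  have [h1 h2] := hnx (u n).
  have h3 : I (u n) <= I (u n.+1) by apply: le_I.
  have h4 : 2^-1 * (F (u n) - I (u n)) <= 2^-1 * ((2^-1) ^+ n * (F x0 - I x0)).
    by rewrite ler_pM2l ?invr_gt0.
  rewrite exprS -mulrA; apply: le_trans h4; apply: le_trans h2.
  by rewrite /= -/(u n); rewrite /= -/(u n) in h3; lra.
have Su n k : S (u n) (u (n + k)%N).
  elim: k => [|k IH]; first by rewrite addn0; exact: Sx.
  by rewrite addnS; apply: Strans IH _; have [] := hnx (u (n + k)%N).
have D0 : 0 <= F x0 - I x0 by rewrite subr_ge0; apply: Il.
have small (ep1 : R) : 0 < ep1 -> exists N, forall z, S (u N) z -> `|z - u N| <= ep1.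
  move=> ep10.
  have dd0 : 0 < ep1 * ep / (F x0 - I x0 + 1) by rewrite divr_gt0 ?mulr_gt0//; lra.
  have [N /(_ N (leqnn N)) hN] := expr2V_lt dd0.
  exists N => z /D h; rewrite -(ler_pM2l ep0); apply: (le_trans h).
  apply: (le_trans (Du N)); move: hN; rewrite ltr_pdivlMr; last lra.
  have : 0 <= (2^-1 : R) ^+ N by rewrite exprn_ge0 ?invr_ge0.
  rewrite [ep * _]mulrC; lra.
have [x hx] : exists l : E, u @ \oo --> l.
  apply: cauchy_seq_cvg => ep1 /small[N hN]; exists N => n Nn; apply: hN.
  by rewrite -(subnKC Nn); exact: Su.
have SX n : S (u n) x.
  have h1 : (fun k => F (u k) + ep * `|u k - u n|) @ \oo --> F x + ep * `|x - u n|.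
    apply: cvgD; first by apply: continuous_cvg => //; exact: cF.
    apply: cvgMr; apply: cvg_norm; apply: cvgB => //; exact: cvg_cst.
  apply: (cvgr_to_le h1).
  by exists n => // k /= nk; rewrite -(subnKC nk); exact: Su.
(* A point violating the inequality would lie in [S x], hence in every [S (u n)]; these sets shrink
   to one point, so it would equal [x]. *)
exists x => y; rewrite leNgt; apply/negP => hy.
have Sy : S x y by rewrite /S /= ltW.
have xy : x = y.
  apply/eqP; rewrite -subr_eq0 -normr_le0; apply/ler_addgt0Pl => ep1 ep10.
  rewrite addr0; have e2 : 0 < ep1 / 2 by rewrite divr_gt0.
  have [N hN] := small _ e2.
  have h1 := hN x (SX N); have h2 := hN y (Strans _ _ _ (SX N) Sy).
  have := ler_distD (u N) x y; rewrite (distrC (u N)); lra.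
by move: hy; rewrite xy subrr normr0 mulr0 addr0 ltxx.
Qed.
End CauchySeq.

Section Directional.
Variables (R : realType) (E : normedModType R).

Lemma sder_ge (f : E -> R) x A v (c : R) : sder f x A ->
  (forall t : R, 0 < t <= 1 -> t * c <= f (x + t *: v) - f x) -> c <= A v.
Proof.
move=> [hA h] hc; have [v0|v0] := eqVneq v 0.
  rewrite v0 in hc *; have := hc 1; rewrite scaler0 addr0 subrr mul1r blin0// => -> //.
  by rewrite ltr01 lexx.
have nv : 0 < `|v| by rewrite normr_gt0.
apply/ler_addgt0Pr => ep ep0; have e1 : 0 < ep / `|v| by rewrite divr_gt0.
have [V /[dup] hV /nbhs_exr[dl dl0 hd] hf] := h _ e1.
pose t := Num.min 1 (dl / (2 * `|v|)).
have t0 : 0 < t by rewrite lt_min ltr01 divr_gt0// mulr_gt0.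
have t1 : t <= 1 by rewrite ge_min lexx.
have Ev : x + t *: v - x = t *: v by rewrite addrAC subrr add0r.
have hV2 : V (x + t *: v).
  apply: hd; rewrite Ev normrZ gtr0_norm//.
  have : t <= dl / (2 * `|v|) by rewrite ge_min lexx orbT.
  by rewrite ler_pdivlMr ?mulr_gt0//; lra.
have := hf _ _ hV2 (nbhs_singleton hV); rewrite Ev blinZr// normrZ gtr0_norm//.
have -> : ep / `|v| * (t * `|v|) = t * ep by field; rewrite gt_eqF.
have tc : t * c <= f (x + t *: v) - f x by apply: hc; rewrite t0.
rewrite ler_norml => /andP[_ h2].
by rewrite -(ler_pM2l t0) mulrDr; lra.
Qed.

Lemma sder_le (f : E -> R) x A v (c : R) : sder f x A ->
  (forall t : R, 0 < t <= 1 -> f (x + t *: v) - f x <= t * c) -> A v <= c.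
Proof.
move=> hf h; rewrite -lerN2.
apply: (sder_ge (f := fun y => - f y) (x := x) (A := fun v => - A v)).
  have := sder_comp hf (sder_lin (f x) (blin_opp (blin_id R))); exact.
by move=> t ht; have := h t ht; rewrite mulrN; lra.
Qed.
End Directional.

Section SquaredNorm.
Variables (R : realType) (E : completeNormedModType R) (e : nat -> E).
Hypothesis hB : one_suppression_unconditional e.
Hypothesis hN : norm_C1_away_from_0 E.
Hypothesis hS : strictly_convex_norm E.

(** Unlike the norm, its square is C^1 at the origin too, so tails may vanish without harm. *)
Definition N2 (x : E) : R := `|x| * `|x|.
Definition G (x : E) : E -> R := 'd N2 x.

Lemma N2_ge0 x : 0 <= N2 x. Proof. exact: mulr_ge0. Qed.
Lemma N2_lip y z : `|N2 y - N2 z| <= (`|y| + `|z|) * `|y - z|.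
Proof.
have -> : N2 y - N2 z = (`|y| + `|z|) * (`|y| - `|z|) by rewrite /N2; ring.
rewrite normrM ger0_norm ?addr_ge0//; apply: ler_wpM2l; first exact: addr_ge0.
exact: ler_dist_dist.
Qed.

Lemma N2_sder x : sder N2 x (G x).
Proof.
suff [A hA] : exists A, sder N2 x A by rewrite /G (sder_diff hA).2.
have [->|x0] := eqVneq x 0.
  exists (fun=> 0); split; first exact: blin_zero.
  move=> ep ep0; have e2 : 0 < ep / 2 by rewrite divr_gt0.
  exists [set y | `|y - 0| < ep / 2]; first exact: nbhs_ballr.
  move=> y z /=; rewrite !subr0 => hy hz; apply: (le_trans (N2_lip _ _)).
  by apply: ler_wpM2r => //; lra.
have oU : open [set x : E | x != 0].
  rewrite openE => y /= y0; have ny : 0 < `|y| by rewrite normr_gt0.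
  apply: filterS (nbhs_ballr y ny) => z /=; apply: contraTneq => ->.
  by rewrite sub0r normrN ltxx.
have h := C1_on_sder1 oU hN x0.
by have := sder_mul h h; exists (fun v => 'd (fun x : E => `|x|) x v * `|x| + `|x| * 'd (fun x : E => `|x|) x v).
Qed.

Lemma blin_G x : blin (G x). Proof. exact: sder_blin (N2_sder x). Qed.

Lemma G_bound x v : `|G x v| <= 2 * `|x| * `|v|.
Proof.
have [->|v0] := eqVneq v 0; first by rewrite (blin0 (blin_G x)) !normr0 mulr0.
have nv : 0 < `|v| by rewrite normr_gt0.
rewrite -ler_pdivrMr//; apply/ler_addgt0Pl => ep ep0; rewrite ler_pdivrMr//.
apply: (sder_bound (N2_sder x)); exists [set y | `|y - x| < ep]; first exact: nbhs_ballr.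
move=> y /= hy; apply: (le_trans (N2_lip _ _)); apply: ler_wpM2r => //.
have := ler_normD (y - x) x; rewrite subrK; lra.
Qed.

Lemma N2_convex x v (t : R) : 0 <= t <= 1 -> N2 (x + t *: v) - N2 x <= t * (N2 (x + v) - N2 x).
Proof.
move=> /andP[t0 t1]; have h : `|x + t *: v| <= (1 - t) * `|x| + t * `|x + v|.
  have -> : x + t *: v = (1 - t) *: x + t *: (x + v).
    by rewrite scalerBl scale1r scalerDr addrA subrK.
  by rewrite (le_trans (ler_normD _ _))// !normrZ !ger0_norm ?subr_ge0.
have h2 : N2 (x + t *: v) <= ((1 - t) * `|x| + t * `|x + v|) ^+ 2.
  by rewrite expr2; apply: ler_pM.
rewrite lerBlDr; apply: (le_trans h2); rewrite /N2 -subr_ge0.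
have -> : t * (`|x + v| * `|x + v| - `|x| * `|x|) + `|x| * `|x| -
   ((1 - t) * `|x| + t * `|x + v|) ^+ 2 = t * (1 - t) * (`|x| - `|x + v|) ^+ 2 by ring.
by rewrite mulr_ge0 ?sqr_ge0// mulr_ge0// subr_ge0.
Qed.

Lemma G_subgrad x v : N2 x + G x v <= N2 (x + v).
Proof.
rewrite addrC -lerBrDr; apply: (sder_le (N2_sder x)) => t /andP[t0 t1].
by apply: N2_convex; rewrite t1 ltW.
Qed.

Lemma N2_Tn_le n m x : (n <= m)%N -> N2 (Tn e m x) <= N2 (Tn e n x).
Proof. by move=> nm; apply: ler_pM => //; exact: Tn_mono. Qed.

Lemma norm_mult1 x n (s : R) : 0 <= s <= 1 -> `|x - s *: (co e x n *: e n)| <= `|x|.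
Proof.
move=> hs; have := @mult_contr R E e hB (fun i => if i == n then s else 0) x n.+1.
rewrite big_ord_recr /= eqxx big1 ?add0r; last first.
  by move=> i _; rewrite ltn_eqF// scale0r.
by apply; move=> i; case: ifP => _ //; rewrite lexx ler01.
Qed.

(** Shrinking one coordinate towards zero does not increase the norm, so the derivative in that
    direction is at most zero. *)
Lemma G_co_ge0 x n : 0 <= co e x n * G x (e n).
Proof.
rewrite -(blinZr (blin_G x)) -oppr_le0 -(blinN (blin_G x)).
apply: (sder_le (N2_sder x)) => t /andP[t0 t1].
rewrite mulr0 subr_le0 scalerN.
by have h := @norm_mult1 x n t; apply: ler_pM => //; apply: h; rewrite t1 ltW.
Qed.

(** A zero partial derivative would, by convexity, make [x] a minimum of the norm on its line in the
    direction [e n]. By suppression [x - co e x n *: e n] is then a minimum too, and strict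
    convexity makes the midpoint strictly smaller. *)
Lemma G_e_neq0 x n : co e x n != 0 -> G x (e n) != 0.
Proof.
move=> xn; apply/eqP => g0.
have x0 : x != 0 by apply: contraNneq xn => ->; rewrite co0.
have nx : 0 < `|x| by rewrite normr_gt0.
have ge (c : R) : `|x| <= `|x + c *: e n|.
  have := G_subgrad x (c *: e n); rewrite (blinZr (blin_G x)) g0 mulr0 addr0.
  by rewrite /N2 -!expr2 ler_pXn2r// ?nnegrE.
have := ge (- co e x n); rewrite scaleNr => w1.
have w2 : `|x - co e x n *: e n| = `|x|.
  by apply/eqP; rewrite eq_le w1 andbT; exact: suppress.
pose k := `|x|^-1.
have k0 : 0 < k by rewrite invr_gt0.
have nk (w : E) : `|w| = `|x| -> `|k *: w| = 1.
  by move=> wx; rewrite normrZ wx (gtr0_norm k0) mulVf ?gt_eqF.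
have := @hS _ _ (nk _ erefl) (nk _ w2).
rewrite -scalerDr scalerA mulrC -scalerA normrZ (gtr0_norm k0) mulrC ltr_pdivrMr// mul1r.
have -> : 2^-1 *: (x + (x - co e x n *: e n)) = x + (- (2^-1 * co e x n)) *: e n.
  rewrite addrA -(mulr2n x) -(scaler_nat 2 x) scalerBr [X in X - _]scalerA mulVf ?pnatr_eq0//.
  by rewrite scale1r scalerA scaleNr.
move=> h; have : `|x| < `|x|; last by rewrite ltxx.
apply: le_lt_trans (ge _) (h _).
apply/eqP => /(scalerI (lt0r_neq0 k0)) /eqP; rewrite -subr_eq0 subKr.
by rewrite scaler_eq0 (negbTE xn) (negbTE (e_neq0 hB n)).
Qed.

(** Adding a tail vector to [Sn e m x] does not change its projection by [Sn e m], and this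
    projection is a contraction, so the norm cannot decrease. Applied to [v] and [- v] this gives
    zero. *)
Lemma G_SnTn m x v : G (Sn e m x) (Tn e m v) = 0.
Proof.
have h w : 0 <= G (Sn e m x) (Tn e m w).
  apply: (sder_ge (N2_sder _)) => t _; rewrite mulr0 subr_ge0.
  have -> : N2 (Sn e m x) = N2 (Sn e m (Sn e m x + t *: Tn e m w)).
    rewrite (blinD (blin_Sn hB m)) (blinZ (blin_Sn hB m)) Sn_Tn// subrr scaler0 addr0.
    congr N2; apply: eq_bigr => i _; congr (_ *: _).
    by rewrite co_Sn// ltn_ord.
  by apply: ler_pM => //; exact: Sn_contr.
apply/eqP; rewrite eq_le h andbT.
have := h (- v); rewrite (blinN (blin_Tn hB m)) (blinN (blin_G _)); lra.
Qed.

(** Ekeland's principle for [N2 - h] yields [x] with [G x] within [ep / 2] of [h]. For large [n] the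
    gradient at [Sn e n x] is within [ep / 2] of [G x], and it annihilates the tails. *)
Lemma shrinking (h : E -> R) (ep : R) : blin h -> 0 < ep ->
  exists N, forall n, (N <= n)%N -> forall v, `|h (Tn e n v)| <= ep * `|v|.
Proof.
move=> hh ep0; have [K K0 hK] := blin_bound hh.
pose F y := N2 y + - h y.
have sF y : sder F y (fun v => G y v + - h v).
  by apply: sder_add; [exact: N2_sder|apply: sder_lin; exact: blin_opp].
have cF : continuous F by move=> y; exact: sder_cont (sF y).
have bF y : - (K * K) <= F y.
  rewrite /F /N2; have := hK y; rewrite ler_norml => /andP[_ h1].
  have := sqr_ge0 (`|y| - K); have := mulr_ge0 (normr_ge0 y) (ltW K0).
  by rewrite expr2; nra.
have e2 : 0 < ep / 2 by rewrite divr_gt0.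
have [x hx] := ekeland cF bF e2.
have dx v : `|G x v - h v| <= ep / 2 * `|v|.
  have lo w : - (ep / 2 * `|w|) <= G x w - h w.
    apply: (sder_ge (sF x)) => t /andP[t0 t1].
    have Ew : x + t *: w - x = t *: w by rewrite addrAC subrr add0r.
    have := hx (x + t *: w); rewrite Ew normrZ gtr0_norm// mulrCA mulrN; lra.
  rewrite ler_norml lo/=; have := lo (- v).
  by rewrite normrN (blinN (blin_G x)) (blinN hh); lra.
have [V /nbhs_exr[dl dl0 hd] hV] := sder_derclose (N2_sder x) e2.
have [N hN1] := Tn_small hB x dl0.
exists N => n Nn v; have hS1 : V (Sn e n x).
  apply: hd; rewrite distrC; exact: hN1.
have := hV _ _ hS1 (N2_sder _) (Tn e n v); rewrite G_SnTn sub0r normrN => h1.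
have h2 := dx (Tn e n v).
have -> : h (Tn e n v) = G x (Tn e n v) - (G x (Tn e n v) - h (Tn e n v)) by rewrite subKr.
apply: (le_trans (ler_normB _ _)).
have : ep / 2 * `|Tn e n v| <= ep / 2 * `|v| by rewrite ler_pM2l// Tn_contr.
lra.
Qed.

Lemma shrinking_row d (A : E -> 'rV[R]_d) (ep : R) : blin A -> 0 < ep ->
  exists N, forall n, (N <= n)%N -> forall v, `|A (Tn e n v)| <= ep * `|v|.
Proof.
move=> hA ep0.
have /choice[N hN1] : forall i, exists N, forall n, (N <= n)%N -> forall v,
    `|A (Tn e n v) ord0 i| <= ep * `|v|.
  move=> i; have hi : blin (fun v => A v ord0 i) := blin_comp hA (blin_coord R i).
  exact: shrinking hi ep0.
exists (\max_i N i) => n Nn v; apply: rV_norm_le; first by rewrite mulr_ge0// ltW.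
move=> i; apply: hN1; apply: leq_trans Nn; exact: leq_bigmax.
Qed.

End SquaredNorm.

(** * Geometric series and the radius function *)

Section GeometricSeries.
Variable R : realType.
Implicit Types u w : nat -> R.

Definition gsum u : R := limn (fun N => \sum_(k < N) u k).
(** Domination by a fixed geometric sequence replaces general summability, since it comes with
    explicit tail bounds. *)
Definition geo (C : R) u := forall k, `|u k| <= C * (2^-1) ^+ k.

Lemma half_gt0 k : 0 < (2^-1 : R) ^+ k.
Proof. by rewrite exprn_gt0// invr_gt0. Qed.

Lemma geo_part C u n N : geo C u -> (n <= N)%N ->
  `|\sum_(k < N) u k - \sum_(k < n) u k| <= 2 * C * (2^-1) ^+ n - 2 * C * (2^-1) ^+ N.
Proof.
move=> hu; elim: N => [|N IH].
  by rewrite leqn0 => /eqP->; rewrite !subrr normr0.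
rewrite leq_eqVlt => /orP[/eqP->|/IH h]; first by rewrite !subrr normr0.
rewrite big_ord_recr /= addrAC (le_trans (ler_normD _ _))//.
have := hu N; rewrite exprS; lra.
Qed.

Lemma gsum_cvg C u : geo C u -> (fun N => \sum_(k < N) u k) @ \oo --> gsum u.
Proof.
move=> hu; have C0 : 0 <= C by have := hu 0; rewrite expr0 mulr1; apply: le_trans.
have [l hl] : exists l : R^o, (fun N => \sum_(k < N) u k) @ \oo --> l.
  apply: (@cauchy_seq_cvg R R) => ep ep0.
  have ep1 : 0 < ep / (2 * C + 1) by rewrite divr_gt0//; lra.
  have [N /(_ N (leqnn N)) hN] := expr2V_lt ep1.
  exists N => n Nn; apply: (le_trans (geo_part hu Nn)).
  have h1 : 0 <= 2 * C * (2^-1) ^+ n.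
    by rewrite mulr_ge0 ?mulr_ge0// ltW// half_gt0.
  have := half_gt0 N; move: hN; rewrite ltr_pdivlMr; last lra.
  lra.
by rewrite /gsum (cvg_lim _ hl).
Qed.

Lemma gsum_uniq u l : (fun N => \sum_(k < N) u k) @ \oo --> (l : R) -> gsum u = l.
Proof. by move=> hl; rewrite /gsum (cvg_lim _ hl). Qed.

Lemma gsum_tail C u n : geo C u -> `|gsum u - \sum_(k < n) u k| <= 2 * C * (2^-1) ^+ n.
Proof.
move=> hu; have C0 : 0 <= C by have := hu 0; rewrite expr0 mulr1; apply: le_trans.
apply: (norm_lim_le (gsum_cvg hu)); exists n => N nN.
apply: (le_trans (geo_part hu nN)); rewrite gerBl.
by rewrite mulr_ge0 ?mulr_ge0// ltW// half_gt0.
Qed.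

Lemma gsum_norm C u : geo C u -> `|gsum u| <= 2 * C.
Proof. by move=> hu; have := gsum_tail 0 hu; rewrite big_ord0 subr0 expr0 mulr1. Qed.

Lemma gsum_le C u c : geo C u -> (forall N, \sum_(k < N) u k <= c) -> gsum u <= c.
Proof.
by move=> hu h; apply: (cvgr_to_le (gsum_cvg hu)); near=> N.
Unshelve. all: by end_near. Qed.

Lemma gsum_ge C u n : geo C u -> (forall k, 0 <= u k) -> \sum_(k < n) u k <= gsum u.
Proof.
move=> hu h; apply: (cvgr_to_ge (gsum_cvg hu)); exists n => // N /= nN.
rewrite -(subnKC nN) big_split_ord /= lerDl; exact: sumr_ge0.
Qed.

Lemma geoZ C u a : geo C u -> geo (`|a| * C) (fun k => a * u k).
Proof. by move=> hu k; rewrite normrM -mulrA ler_wpM2l. Qed.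

Lemma gsumD C D u w : geo C u -> geo D w -> gsum (fun k => u k + w k) = gsum u + gsum w.
Proof.
move=> hu hw; apply: gsum_uniq.
have -> : (fun N => \sum_(k < N) (u k + w k)) =
  (fun N => \sum_(k < N) u k) + (fun N => \sum_(k < N) w k).
  by apply/funext => N; rewrite fctE big_split.
by apply: cvgD; [exact: gsum_cvg hu|exact: gsum_cvg hw].
Qed.
Lemma gsumZ C u a : geo C u -> gsum (fun k => a * u k) = a * gsum u.
Proof.
move=> hu; apply: gsum_uniq.
have -> : (fun N => \sum_(k < N) (a * u k)) = a *: (fun N => \sum_(k < N) u k).
  by apply/funext => N; rewrite -mulr_sumr.
by apply: cvgZr; exact: gsum_cvg hu.
Qed.
Lemma gsumB C D u w : geo C u -> geo D w -> gsum (fun k => u k - w k) = gsum u - gsum w.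
Proof.
move=> hu hw; have hw' := geoZ (-1) hw.
rewrite -[- gsum w]mulN1r -(gsumZ (-1) hw) -(gsumD hu hw').
by congr gsum; apply/funext => k; rewrite mulN1r.
Qed.

Lemma gsum_fin u n : (forall k, (n <= k)%N -> u k = 0) -> gsum u = \sum_(k < n) u k.
Proof.
move=> h; rewrite /gsum; apply: cvg_lim => //; apply: cvg_near_cst; exists n => // N /= nN.
rewrite -(subnKC nN) big_split_ord /= [X in _ + X]big1 ?addr0// => i _.
by apply: h; rewrite leq_addr.
Qed.

(** Geometrically decaying Lipschitz constants make the tails of the series and of its derivative
    small uniformly near [x]; the head is a finite sum. *)
Lemma sder_series (E : normedModType R) (h : nat -> E -> R) x (A : nat -> E -> R)
    (V : set E) (C : R) : nbhs x V ->
  (forall y, V y -> geo C (h^~ y)) ->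
  (forall y z, V y -> V z -> geo (C * `|y - z|) (fun k => h k y - h k z)) ->
  (forall k, sder (h k) x (A k)) ->
  sder (fun y => gsum (h^~ y)) x (fun v => gsum (A^~ v)).
Proof.
move=> hV hC hL hA.
have C0 : 0 <= C.
  by have := hC x (nbhs_singleton hV) 0; rewrite expr0 mulr1; apply: le_trans.
have gA v : geo (C * `|v|) (A^~ v).
  move=> k; rewrite mulrAC; apply: (sder_bound (hA k)); exists V => // y Vy.
  by rewrite mulrAC; apply: hL => //; exact: nbhs_singleton.
split.
  split.
    move=> u v; rewrite -(gsumD (gA u) (gA v)); congr gsum; apply/funext => k.
    by rewrite (blinD (sder_blin (hA k))).
  split.
    move=> a v; rewrite -[RHS](gsumZ a (gA v)); congr gsum; apply/funext => k.
    by rewrite (blinZ (sder_blin (hA k))).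
  exists (2 * C); first by rewrite mulr_ge0.
  by move=> v; rewrite -mulrA; exact: gsum_norm.
(* Two tails, one of increments and one of derivatives, cost [4 * C * (2^-1) ^+ N] together, which
   this choice puts below [ep / 2]. Adding 1 covers [C = 0]. *)
move=> ep ep0; have ep1 : 0 < ep / (8 * C + 1) by rewrite divr_gt0//; lra.
have [N /(_ N (leqnn N)) hN] := expr2V_lt ep1.
have ep2 : 0 < ep / 2 by rewrite divr_gt0.
have [W hW hf] := (sder_sum (index_enum 'I_N) (fun k : 'I_N => hA k)).2 _ ep2.
exists (V `&` W); first exact: filterI.
move=> y z [Vy Wy] [Vz Wz].
have := hf y z Wy Wz; rewrite /= => h1.
have h2 := gsum_tail N (hL y z Vy Vz).
rewrite (gsumB (hC y Vy) (hC z Vz)) in h2.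
have h3 := gsum_tail N (gA (y - z)).
have -> : gsum (h^~ y) - gsum (h^~ z) - gsum (A^~ (y - z)) =
  (gsum (h^~ y) - gsum (h^~ z) - \sum_(k < N) (h k y - h k z)) +
  (\sum_(k < N) h k y - \sum_(k < N) h k z - \sum_(k < N) A k (y - z)) -
  (gsum (A^~ (y - z)) - \sum_(k < N) A k (y - z)).
  rewrite sumrB; ring.
apply: (le_trans (ler_normB _ _)); apply: le_trans (lerD _ h3) _.
  apply: le_trans (ler_normD _ _) _; exact: lerD h2 h1.
have h4 : 4 * C * (2^-1) ^+ N <= ep / 2.
  by move: hN (half_gt0 N); rewrite ltr_pdivlMr; [lra|lra].
have := ler_wpM2r (normr_ge0 (y - z)) h4; lra.
Qed.

End GeometricSeries.

Section Radius.
Variables (R : realType) (E : completeNormedModType R) (e : nat -> E).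
Hypothesis hB : one_suppression_unconditional e.
Hypothesis hN : norm_C1_away_from_0 E.

Definition bump (q : E) (s : R) (x : E) : R := psq (1 - s^-2 * N2 (x - q)).

Lemma bump_sder q s x : exists A, sder (bump q s) x A.
Proof.
have h1 : sder (fun y => y - q) x (fun v => v + 0).
  by apply: sder_add; [exact: (sder_lin x (blin_id E)) | exact: sder_cst].
have h2 := sder_comp h1 (N2_sder hN (x - q)).
have h3 := sder_comp h2 (sder_lin _ (blin_mul (- s^-2) (blin_id R))).
have h4 := sder_add (sder_cst (1 : R) x) h3.
have h5 := sder_comp h4 (sder_psq _).
eexists; apply: (sder_near h5); exists setT; first exact: filterT.
by move=> y _; rewrite /bump mulNr.
Qed.

Lemma bump_ge0 q s x : 0 <= bump q s x. Proof. exact: psq_ge0. Qed.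

Lemma bump_out q s x : 0 < s -> s <= `|x - q| -> bump q s x = 0.
Proof.
move=> s0 h; rewrite /bump /psq; case: (pposE (1 - s^-2 * N2 (x - q))) => [[h1 ->]|[_ ->]].
  have : 1 <= s^-2 * N2 (x - q).
    rewrite mulrC ler_pdivlMr ?exprn_gt0// mul1r expr2; apply: ler_pM => //; exact: ltW.
  move=> h2; have -> : 1 - s^-2 * N2 (x - q) = 0 by move: h2 h1; set z := _ * _; lra.
  by rewrite expr0n.
by rewrite expr0n.
Qed.

Lemma bump_in q s x : 0 < s -> `|x - q| < s -> 0 < bump q s x.
Proof.
move=> s0 h; rewrite /bump /psq; have h2 : s^-2 * N2 (x - q) < 1.
  by rewrite mulrC ltr_pdivrMr ?exprn_gt0// mul1r expr2 /N2; apply: ltr_pM.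
case: (pposE (1 - s^-2 * N2 (x - q))) => [[h1 ->]|[h1 _]]; last lra.
by rewrite exprn_gt0//; lra.
Qed.

Lemma bump_le1 q s x : bump q s x <= 1.
Proof.
rewrite /bump /psq; case: (pposE (1 - s^-2 * N2 (x - q))) => [[h ->]|[_ ->]].
  have : 0 <= s^-2 * N2 (x - q) by rewrite mulr_ge0 ?N2_ge0// invr_ge0 exprn_even_ge0.
  by move=> h1; rewrite expr_le1//; lra.
by rewrite expr0n ler01.
Qed.

Lemma bump_profile_lip (a b : R) : 0 <= a -> 0 <= b ->
  `|psq (1 - a * a) - psq (1 - b * b)| <= 4 * `|a - b|.
Proof.
wlog ab : a b / a <= b.
  move=> h a0 b0; case/orP: (le_total a b) => ab; first exact: h.
  by rewrite distrC (distrC a); apply: h.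
move=> a0 b0; rewrite (distrC a) (ger0_norm (_ : 0 <= b - a)) ?subr_ge0// /psq.
case: (pposE (1 - a * a)) (pposE (1 - b * b)) => [[ha ->]|[ha ->]] [[hb ->]|[hb ->]].
- rewrite ger0_norm; last first.
    by rewrite subr_ge0 ler_pXn2r ?nnegrE// lerB// ler_pM.
  have -> : (1 - a * a) ^+ 2 - (1 - b * b) ^+ 2 = (b - a) * ((b + a) * (2 - a * a - b * b)) by ring.
  rewrite mulrC; apply: ler_wpM2r; first lra.
  have a1 : a <= 1 by nra.
  have b1 : b <= 1 by nra.
  have h1 : (b + a) * (2 - a * a - b * b) <= (1 + 1) * 2.
    apply: ler_pM; nra.
  lra.
- have a1 : a <= 1 by nra.
  have b1 : 1 <= b by nra.
  rewrite expr0n subr0 ger0_norm ?sqr_ge0//.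
  have : (1 - a * a) ^+ 2 <= (1 - a * a) * 1 by rewrite expr2; apply: ler_wpM2l; nra.
  nra.
- nra.
- by rewrite !expr0n subrr normr0; lra.
Qed.

Lemma bump_lip q s x y : 0 < s -> `|bump q s x - bump q s y| <= 4 / s * `|x - y|.
Proof.
move=> s0; rewrite /bump /N2.
have Eq z : s^-2 * (`|z| * `|z|) = (`|z| / s) * (`|z| / s).
  by rewrite expr2 invfM; ring.
rewrite !Eq; apply: (le_trans (bump_profile_lip _ _)).
- by rewrite divr_ge0// ltW.
- by rewrite divr_ge0// ltW.
rewrite -mulrBl normrM (gtr0_norm (_ : 0 < s^-1)) ?invr_gt0//.
rewrite -mulrA [s^-1 * _]mulrC; apply: ler_wpM2l => //; apply: ler_wpM2r.
  by rewrite invr_ge0 ltW.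
apply: (le_trans (ler_dist_dist _ _)); by rewrite opprB addrA subrK.
Qed.

(* [r] is a sum of bumps over a countable dense family of balls; if every ball containing [x] had
   admissible scale below [r x], the sum defining [r x] would be at most [r x / 2]. *)
Lemma exists_radius (U : set E) (Good : E -> R -> Prop) (eta : R) : 0 < eta ->
  (forall x s t, s <= t -> Good x t -> Good x s) ->
  (forall x, U x -> exists2 m : R, 0 < m & exists2 V, nbhs x V & forall y, V y -> U y /\ Good y m) ->
  exists r : E -> R, (forall x, exists A, sder r x A) /\
    (forall x y, `|r x - r y| <= eta * `|x - y|) /\
    (forall x, 0 <= r x) /\ (forall x, 0 < r x -> U x /\ Good x (r x)) /\
    (forall x, U x -> 0 < r x).
Proof.
move=> eta0 gd gl.
(* A code [k] stands for a ball: a rational combination of basis vectors as centre and a natural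
   number for the radius. An invalid code gets centre 0 and radius 1. *)
pose dat (k : nat) : seq rat * nat := odflt ([::], 0%N) (unpickle k).
pose q k : E := \sum_(i < size (dat k).1) ratr (dat k).1`_i *: e i.
pose s k : R := ((dat k).2.+1)%:R^-1.
have s0 k : 0 < s k by rewrite invr_gt0.
have s1 k : s k <= 1 by rewrite invf_le1// ler1n.
pose P k (m : R) := 0 < m /\ forall y, `|y - q k| < s k -> U y /\ Good y m.
pose m k := xget 0 (P k).
have mP k : m k = 0 \/ P k (m k) by rewrite /m; case: xgetP => [? _|]; [right|left].
have m0 k : 0 <= m k by case: (mP k) => [->//|[/ltW]].
(* The first bound keeps the sum below an admissible scale; the second compensates the factor
   [4 / s k] in the Lipschitz constant of the bump. *)
pose c k := Num.min (m k) (eta * s k / 16).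
have c0 k : 0 <= c k by rewrite le_min m0/= divr_ge0// mulr_ge0// ltW.
(* With the exponent [k.+2] the weights add up to 1/2. *)
pose h k x := c k * (2^-1) ^+ k.+2 * bump (q k) (s k) x.
have hge k x : 0 <= h k x by rewrite mulr_ge0 ?bump_ge0// mulr_ge0// ltW// half_gt0.
have cs k : c k <= eta * s k / 16 by rewrite ge_min lexx orbT.
have g1 x : geo eta (h^~ x).
  move=> k; rewrite ger0_norm// /h.
  have h1 : c k <= eta by apply: le_trans (cs k) _; have := s1 k; nra.
  have h2 : (2^-1) ^+ k.+2 * bump (q k) (s k) x <= (2^-1) ^+ k.
    rewrite -[leRHS]mulr1; apply: ler_pM; rewrite ?bump_ge0 ?bump_le1//.
    by rewrite !exprS; have := half_gt0 R k; lra.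
  rewrite -mulrA; apply: ler_pM => //; rewrite mulr_ge0 ?bump_ge0// ltW// half_gt0.
have g2 x y : geo (eta / 2 * `|x - y|) (fun k => h k x - h k y).
  move=> k; rewrite /h -mulrBr normrM ger0_norm; last by rewrite mulr_ge0// ltW// half_gt0.
  have h1 := @bump_lip (q k) (s k) x y (s0 k).
  have p0 := half_gt0 R k.
  have h2 : c k * (4 / s k) <= eta / 4.
    rewrite mulrA ler_pdivrMr//; have := cs k; lra.
  rewrite !exprS; rewrite -!mulrA.
  apply: (@le_trans _ _ (c k * (2^-1 * (2^-1 * ((2^-1) ^+ k * (4 / s k * `|x - y|)))))).
    by do 4 apply: ler_wpM2l => //; rewrite ?invr_ge0// ltW.
  have -> : c k * (2^-1 * (2^-1 * ((2^-1) ^+ k * (4 / s k * `|x - y|)))) =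
    4^-1 * (c k * (4 / s k)) * ((2^-1) ^+ k * `|x - y|) by field; rewrite ?gt_eqF.
  have -> : eta * (2^-1 * (`|x - y| * (2^-1) ^+ k)) = eta / 2 * ((2^-1) ^+ k * `|x - y|) by field; rewrite ?gt_eqF.
  apply: ler_wpM2r; last by lra.
  by rewrite mulr_ge0// ltW.
have hs k x : exists A, sder (h k) x A.
  have [A hA] := bump_sder (q k) (s k) x; eexists.
  exact: (sder_comp hA (sder_lin _ (blin_mul (c k * (2^-1) ^+ k.+2) (blin_id R)))).
exists (fun x => gsum (h^~ x)).
have rpos x k : P k (m k) -> `|x - q k| < s k -> 0 < gsum (h^~ x).
  move=> [mk _] xq; apply: lt_le_trans (gsum_ge k.+1 (g1 x) (fun j => hge j x)).
  rewrite big_ord_recr /=; apply: ltr_wpDl; first exact: sumr_ge0.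
  rewrite /h mulr_gt0 ?bump_in// mulr_gt0 ?half_gt0// lt_min mk/= divr_gt0//.
  by rewrite mulr_gt0.
split.
  move=> x; have /choice[A hA] := fun k => hs k x.
  eexists; apply: (@sder_series _ _ h x A setT (eta + eta)) => //.
  - exact: filterT.
  - move=> y _ k; apply: le_trans (g1 y k) _; apply: ler_wpM2r; last lra.
    by rewrite ltW// half_gt0.
  - move=> y z _ _ k; apply: le_trans (g2 y z k) _; apply: ler_wpM2r; first by rewrite ltW// half_gt0.
    apply: ler_wpM2r => //; lra.
split.
  move=> x y; rewrite -(gsumB (g1 x) (g1 y)).
  by apply: (le_trans (gsum_norm (g2 x y))); rewrite mulrA mulrCA divff// mulr1.
split; first by move=> x; have := gsum_ge 0 (g1 x) (fun k => hge k x); rewrite big_ord0.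
split.
  move=> x rx.
  have [k [Pk xq mk]] : exists k, [/\ P k (m k), `|x - q k| < s k & gsum (h^~ x) <= m k].
    apply: contrapT => nk.
    have hk k : h k x <= gsum (h^~ x) * (2^-1) ^+ k.+2.
      have [xq|xq] := ltP `|x - q k| (s k); last first.
        by rewrite /h bump_out// mulr0 mulr_ge0// ltW// half_gt0.
      have [mk|Pk] := mP k.
        have -> : h k x = 0.
          have c00 : c k = 0.
            by apply/eqP; rewrite eq_le c0 andbT ge_min mk lexx.
          by rewrite /h c00 !mul0r.
        by rewrite mulr_ge0// ltW// half_gt0.
      have mr : m k <= gsum (h^~ x).
        by rewrite leNgt; apply/negP => mr; apply: nk; exists k; split => //; exact: ltW.
      rewrite /h -mulrA; apply: ler_pM => //.
      - by rewrite mulr_ge0 ?bump_ge0// ltW// half_gt0.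
      - by apply: le_trans mr; rewrite ge_min lexx.
      - by rewrite ler_piMr ?bump_le1// ltW// half_gt0.
    have : gsum (h^~ x) <= gsum (h^~ x) / 2.
      apply: (gsum_le (g1 x)) => N.
      apply: (@le_trans _ _ (gsum (h^~ x) / 2 - gsum (h^~ x) / 2 * (2^-1) ^+ N)).
        elim: N => [|N IH]; first by rewrite big_ord0 expr0; lra.
        rewrite big_ord_recr /=; have := hk N; rewrite !exprS; lra.
      by rewrite gerBl mulr_ge0 ?divr_ge0// ltW// half_gt0.
    lra.
  have [mk0 /(_ x xq)[Ux gx]] := Pk; split => //; exact: gd mk gx.
move=> x Ux; have [mu mu0 [V hV hg]] := gl x Ux.
have [dl dl0 hd] := nbhs_exr hV.
have dl2 : 0 < dl / 2 by rewrite divr_gt0.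
(* The index [M] makes the radius less than [dl / 2], so a ball of this radius that contains [x]
   stays inside [V]. *)
pose M := Num.bound (2 / dl).
have sM : (M.+1)%:R^-1 < dl / 2 :> R.
  rewrite invf_plt ?posrE// invf_div (lt_le_trans (archi_boundP _))//.
    by rewrite divr_ge0// ltW.
  by rewrite ler_nat.
have sM0 : 0 < (M.+1)%:R^-1 :> R by rewrite invr_gt0.
have [l hl] := rat_span_dense hB x sM0.
pose k := pickle (l, M).
have dk : dat k = (l, M) by rewrite /dat /k pickleK.
have Pk : P k mu.
  split => // y hy; apply/hg/hd.
  have Eq : q k = \sum_(i < size l) ratr l`_i *: e i by rewrite /q dk.
  rewrite -Eq in hl; rewrite /s dk /= in hy.
  have -> : y - x = (y - q k) - (x - q k) by rewrite opprB addrA subrK.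
  apply: le_lt_trans (ler_normB _ _) _. rewrite [dl]splitr; apply: ltrD; [exact: lt_trans hy sM | exact: lt_trans hl sM].
apply: (rpos x k); last by rewrite /s /q dk.
by rewrite /m; apply: (@xgetPex _ 0 (P k)); exists mu.
Qed.

End Radius.

(** * The cut-off map *)

Section Cutoff.
Variable R : realType.

(** A C^1 step function, equal to 0 up to 1 and to 1 from 2 on. *)
Definition chi (s : R) : R := 1 - psq (1 - psq (s - 1)).
Definition dchi (s : R) : R := 4 * ppos (1 - psq (s - 1)) * ppos (s - 1).

Lemma chi_sder s : sder chi s (fun h => dchi s * h).
Proof.
have h1 : sder (fun y : R => y - 1) s (fun v => v + 0).
  by apply: sder_add; [exact: (sder_lin s (blin_id R)) | exact: sder_cst].
have h2 := sder_comp h1 (sder_psq (s - 1)).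
have h3 := sder_add (sder_cst (1 : R) s) (sder_comp h2 (sder_lin _ (blin_opp (blin_id R)))).
have h4 := sder_comp h3 (sder_psq _).
have h5 := sder_add (sder_cst (1 : R) s) (sder_comp h4 (sder_lin _ (blin_opp (blin_id R)))).
apply: (sder_eqd h5) => v; rewrite /dchi; ring.
Qed.

Lemma ppos_le1 (u : R) : u <= 1 -> ppos u <= 1.
Proof. by move=> u1; case: (pposE u) => [[_ ->]|[_ ->]]//; rewrite ler01. Qed.
Lemma psq_le1 (u : R) : u <= 1 -> psq u <= 1.
Proof. by move=> u1; rewrite /psq expr_le1 ?ppos_ge0//; exact: ppos_le1. Qed.
Lemma ppos0 (u : R) : u <= 0 -> ppos u = 0.
Proof. by move=> u0; rewrite /ppos; apply/max_idPr. Qed.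
Lemma ppos_id (u : R) : 0 <= u -> ppos u = u.
Proof. by move=> u0; rewrite /ppos; apply/max_idPl. Qed.

Lemma chi01 s : 0 <= chi s <= 1.
Proof.
rewrite /chi; have h := psq_ge0 (1 - psq (s - 1)).
have : psq (1 - psq (s - 1)) <= 1 by apply: psq_le1; have := psq_ge0 (s - 1); lra.
lra.
Qed.

Lemma chi_eq1 s : 2 <= s -> chi s = 1.
Proof.
move=> s2; rewrite /chi /psq [ppos (1 - _)]ppos0 ?expr0n ?subr0//.
rewrite ppos_id; last lra.
by rewrite subr_le0 expr2; nra.
Qed.

Lemma chi_gt0 s : 1 < s -> 0 < chi s.
Proof.
move=> s1; rewrite /chi subr_gt0; have h : 0 < psq (s - 1).
  by rewrite /psq ppos_id ?exprn_gt0//; lra.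
rewrite /psq; case: (pposE (1 - ppos (s - 1) ^+ 2)) => [[h1 ->]|[_ ->]]; last by rewrite expr0n.
rewrite /psq in h; rewrite expr_lt1//; lra.
Qed.

Lemma chi_neq0 s : chi s != 0 -> 1 < s.
Proof.
apply: contraNT; rewrite -leNgt => s1; rewrite /chi {2}/psq (ppos0 (_ : s - 1 <= 0)); last lra.
by rewrite expr0n subr0 /psq ppos_id// expr1n subrr.
Qed.

Lemma dchi_bounds s : 0 <= dchi s <= 4.
Proof.
rewrite /dchi -mulrA; have p := ppos_ge0 (s - 1); have q := ppos_ge0 (1 - psq (s - 1)).
rewrite mulr_ge0 ?mulr_ge0//=; have q1 : ppos (1 - psq (s - 1)) <= 1.
  by apply: ppos_le1; have := psq_ge0 (s - 1); lra.
have [s2|s2] := lerP 1 (ppos (s - 1)).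
  have -> : ppos (1 - psq (s - 1)) = 0.
    by apply: ppos0; rewrite subr_le0 /psq expr_ge1.
  by rewrite mul0r mulr0.
have : ppos (1 - psq (s - 1)) * ppos (s - 1) <= 1 * 1 by apply: ler_pM => //; exact: ltW.
lra.
Qed.

Lemma dchi_neq0 s : dchi s != 0 -> 1 < s < 2.
Proof.
move=> h; apply/andP; split; rewrite ltNge; apply: contraNN h => hs; rewrite /dchi.
  by rewrite (ppos0 (_ : s - 1 <= 0)) ?mulr0//; lra.
rewrite [ppos (1 - _)]ppos0 ?mulr0 ?mul0r//.
by rewrite /psq ppos_id ?subr_le0 ?expr2; nra.
Qed.

(** The step is flat at its extreme values; this freezes the derivative of the cut-off map at
    indices of weight 1. *)
Lemma chi1_dchi0 s : chi s = 1 -> dchi s = 0.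
Proof.
rewrite /chi => h; have : psq (1 - psq (s - 1)) = 0 by lra.
by rewrite /psq => /eqP; rewrite sqrf_eq0 /dchi /psq => /eqP->; rewrite mulr0 mul0r.
Qed.

Lemma chi0_dchi0 s : chi s = 0 -> dchi s = 0.
Proof.
move=> h; apply/eqP; apply: contraTT isT => /dchi_neq0/andP[/chi_gt0]; by rewrite h ltxx.
Qed.
End Cutoff.

Section CutMap.
Variables (R : realType) (E : completeNormedModType R) (e : nat -> E).
Hypothesis hB : one_suppression_unconditional e.
Hypothesis hN : norm_C1_away_from_0 E.
Variables (r : E -> R) (Dr : E -> E -> R).
Hypothesis rD : forall x, sder r x (Dr x).
Hypothesis r0 : forall x, 0 <= r x.
Hypothesis rlip : forall x y, `|r x - r y| <= 256^-1 * `|x - y|.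

Local Notation co := (co e).
Local Notation Tn := (Tn e).
Local Notation Sn := (Sn e).

Definition dyadic (n : nat) : R := (2^-1) ^+ n.
(** The dyadic term keeps the denominator positive. It also prevents a nonzero weight at [n] unless
    [dyadic n] is below the radius, which sends active indices far out, where [Df] is small on
    tails. *)
Definition Q (n : nat) (x : E) : R := dyadic n * dyadic n + N2 (Tn n x).

Lemma dyadic_gt0 n : 0 < dyadic n. Proof. by rewrite /dyadic exprn_gt0// invr_gt0. Qed.
Lemma dyadic_le n m : (n <= m)%N -> dyadic m <= dyadic n.
Proof.
move=> nm; rewrite /dyadic -(subnKC nm) exprD ler_piMr ?exprn_ge0 ?invr_ge0//.
by rewrite exprn_ile1 ?invr_ge0// invf_le1// ler1n.
Qed.
Lemma Q_gt0 n x : 0 < Q n x.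
Proof. by rewrite ltr_wpDr ?N2_ge0// mulr_gt0 ?dyadic_gt0. Qed.
Lemma Q_mono n m x : (n <= m)%N -> Q m x <= Q n x.
Proof.
move=> nm; apply: lerD; last exact: N2_Tn_le.
by apply: ler_pM; rewrite ?dyadic_le// ltW// dyadic_gt0.
Qed.
Lemma sqr_lt_of (a t q : R) : 0 <= t -> a * a <= q -> q < t * t -> a < t.
Proof.
move=> t0 h1 h2; rewrite ltNge; apply/negP => ta.
have : t * t <= a * a by apply: ler_pM.
lra.
Qed.
Lemma sqr_le_of (a t q : R) : 0 <= t -> a * a <= q -> q <= t * t -> a <= t.
Proof.
move=> t0 h1 h2; rewrite leNgt; apply/negP => ta.
have : t * t < a * a by apply: ltr_pM.
lra.
Qed.
Lemma dyadic_Q n x : dyadic n * dyadic n <= Q n x.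
Proof. by rewrite lerDl N2_ge0. Qed.
Lemma Tn_Q n x : `|Tn n x| * `|Tn n x| <= Q n x.
Proof. by rewrite lerDr mulr_ge0 ?ltW ?dyadic_gt0. Qed.

Lemma Q_sder n x : sder (Q n) x (fun v => G (Tn n x) (Tn n v)).
Proof.
have h := sder_add (sder_cst (dyadic n * dyadic n) x)
  (sder_comp (sder_lin x (blin_Tn hB n)) (N2_sder hN (Tn n x))).
by apply: (sder_eqd h) => v; rewrite add0r.
Qed.

(* The cut-off weight is read off at [Y n x] and not at [x], so that the derivative of the weight
   vanishes in the directions killed by [DY n x], up to the contribution of the tail. *)
Fixpoint Y (n : nat) (x : E) : E :=
  if n is m.+1 then Y m x + ((1 - chi (r (Y m x) * r (Y m x) / Q m x)) * co x m) *: e m else 0.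
Definition sq n x : R := r (Y n x) * r (Y n x) / Q n x.
Definition w n x : R := chi (sq n x).

Lemma YS n x : Y n.+1 x = Y n x + ((1 - w n x) * co x n) *: e n.
Proof. by []. Qed.

Fixpoint DY (n : nat) (x v : E) : E :=
  if n is m.+1 then DY m x v + ((1 - w m x) * co v m - co x m *
     (dchi (sq m x) * (2 * r (Y m x) * Dr (Y m x) (DY m x v) / Q m x -
        r (Y m x) * r (Y m x) / (Q m x * Q m x) * G (Tn m x) (Tn m v)))) *: e m
  else 0.
(** This repeats the factor written out inside [DY], because it refers to [DY] itself. *)
Definition Dw m x v : R := dchi (sq m x) * (2 * r (Y m x) * Dr (Y m x) (DY m x v) / Q m x -
        r (Y m x) * r (Y m x) / (Q m x * Q m x) * G (Tn m x) (Tn m v)).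
Lemma DYS n x v : DY n.+1 x v = DY n x v + ((1 - w n x) * co v n - co x n * Dw n x v) *: e n.
Proof. by []. Qed.

Lemma Y_sder n x : sder (Y n) x (DY n x).
Proof.
elim: n => [|n IH]; first exact: sder_cst.
have h1 := sder_comp IH (rD (Y n x)).
have h2 := sder_mul (sder_mul h1 h1) (sder_comp (Q_sder n x) (sder_inv (lt0r_neq0 (Q_gt0 n x)))).
have h3 := sder_comp h2 (chi_sder (sq n x)).
have h4 := sder_add (sder_cst (1 : R) x) (sder_comp h3 (sder_lin _ (blin_opp (blin_id R)))).
have h5 := sder_mul h4 (sder_lin x (blin_co hB n)).
have h6 := sder_add IH (sder_comp h5 (sder_lin _ (blin_vec (e n)))).
apply: (sder_eqd h6) => v; rewrite DYS; congr (_ + _ *: _).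
rewrite /Dw /w; move: (dchi _) (chi _) => dc c.
by field; rewrite gt_eqF// Q_gt0.
Qed.

Lemma w01 n x : 0 <= w n x <= 1. Proof. exact: chi01. Qed.

Lemma Y_eq n x : Y n x = \sum_(i < n) (1 - w i x) *: (co x i *: e i).
Proof.
elim: n => [|n IH]; first by rewrite big_ord0.
by rewrite YS big_ord_recr /= IH scalerA.
Qed.

Definition quiet n x := forall i, (i < n)%N -> w i x = 0.

(** The coordinates below [n] are untouched, so the difference is the tail at [n] with a multiplier
    in [0, 1] removed. *)
Lemma Y_close n m x : quiet n x -> (n <= m)%N -> `|x - Y m x| <= `|Tn n x|.
Proof.
move=> hq nm.
have -> : x - Y m x = Tn n x - \sum_(i < m) (if (i < n)%N then 0 else 1 - w i x) *: (co (Tn n x) i *: e i).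
  rewrite Y_eq -(subnKC nm) big_split_ord [in RHS]big_split_ord /=.
  rewrite [X in _ - (X + _) = _](_ : _ = Sn n x); last first.
    by apply: eq_bigr => i _; rewrite hq// subr0 scale1r.
  rewrite [X in _ = _ - (X + _)]big1 ?add0r; last by move=> i _; rewrite ltn_ord scale0r.
  rewrite opprD addrA; congr (_ - _); apply: eq_bigr => i _.
  by rewrite ltnNge leq_addr co_Tn// ltnNge leq_addr.
apply: (mult_contr hB (s := fun i => if (i < n)%N then 0 else 1 - w i x)) => i.
by case: ifP => _; have := w01 i x; lra.
Qed.

(** Both [x] and the later stages [Y m x] satisfy this condition, so that [w_eq1] can be used with
    either as comparison point. *)
Definition close n x z := forall i, (i <= n)%N -> quiet i x -> `|x - z| <= `|Tn i x|.
Lemma close_self n x : close n x x.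
Proof. by move=> i _ _; rewrite subrr normr0. Qed.
Lemma close_Y n m x : (n <= m)%N -> close n x (Y m x).
Proof. by move=> nm i iin hi; apply: Y_close => //; exact: leq_trans nm. Qed.

Lemma loud_first n x : ~ quiet n x -> exists i, [/\ (i < n)%N, quiet i x & w i x != 0].
Proof.
move=> h; have [|i /andP[Pi1 Pi2] imin] := @ex_minnP (fun i => (i < n)%N && (w i x != 0)).
  apply: contrapT => h2; apply: h => i iin; apply/eqP; apply: contrapT => wi.
  by apply: h2; exists i; rewrite iin; apply/negP.
exists i; split => // j ji; apply/eqP; apply: contraT => wj.
have := imin j; rewrite (ltn_trans ji Pi1) wj => /(_ isT); by rewrite leqNgt ji.
Qed.

Lemma w_neq0 n x : w n x != 0 -> dyadic n < r (Y n x) /\ `|Tn n x| < r (Y n x).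
Proof.
move/chi_neq0; rewrite /sq ltr_pdivlMr ?Q_gt0// mul1r => h.
by split; apply: sqr_lt_of h; rewrite ?dyadic_Q ?Tn_Q.
Qed.

(** A nonzero weight at [i] bounds the tail by [r (Y i x)]; two points within the tail are at most
    twice as far apart, and [2 / 256 = 1 / 128]. *)
Lemma r_close i x z z' : quiet i x -> w i x != 0 -> `|x - z| <= `|Tn i x| ->
  `|x - z'| <= `|Tn i x| -> `|r z - r z'| <= 128^-1 * r (Y i x).
Proof.
move=> qi /w_neq0[_ wi] hz hz'; apply: (le_trans (rlip _ _)).
have := ler_distD x z z'; rewrite (distrC z x); lra.
Qed.

Lemma r_ratio i x z z' : quiet i x -> w i x != 0 -> `|x - z| <= `|Tn i x| ->
  `|x - z'| <= `|Tn i x| -> 31 / 32 * r z <= r z'.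
Proof.
move=> qi wi hz hz'; have h1 := r_close qi wi hz hz'.
have h2 := r_close qi wi (Y_close qi (leqnn i)) hz; have := r0 (Y i x).
move: h1 h2; rewrite !ler_norml; lra.
Qed.

(** Either all weights below [n] vanish, and then the tail at [n] is at most [r z / 2], or there is
    a first nonzero weight, and [r_ratio] applies there. In both cases [r (Y n x)] is close to
    [r z]. *)
Lemma w_eq1 n x z : close n x z -> 4 * Q n x <= r z * r z -> w n x = 1.
Proof.
move=> hz hQ; apply: chi_eq1; rewrite /sq ler_pdivlMr ?Q_gt0//.
(* As [4 * 9 / 16] exceeds 2, this ratio puts the argument of [chi] past 2. *)
suff h : 3 / 4 * r z <= r (Y n x).
  have h1 : (3 / 4 * r z) * (3 / 4 * r z) <= r (Y n x) * r (Y n x).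
    by apply: ler_pM => //; rewrite mulr_ge0.
  have := mulr_ge0 (r0 z) (r0 z); lra.
have [q|/loud_first[i [iin qi wi]]] := pselect (quiet n x).
  have h1 := hz n (leqnn n) q; have h2 := Y_close q (leqnn n).
  have : `|Tn n x| <= r z / 2.
    apply: (sqr_le_of (q := Q n x)); [by rewrite divr_ge0|exact: Tn_Q|lra].
  have := rlip z (Y n x); have := ler_distD x z (Y n x); rewrite (distrC z x).
  rewrite [`|r _ - _| <= _]ler_norml; have := r0 z; lra.
have := r_ratio qi wi (hz i (ltnW iin) qi) (Y_close qi (ltnW iin)).
have := r0 z; lra.
Qed.

Definition settled N x := forall n, (N <= n)%N -> w n x = 1.

Lemma settled_Y N m x : settled N x -> (N <= m)%N -> Y m x = Y N x.
Proof.
move=> hs; elim: m => [|m IH]; first by rewrite leqn0 => /eqP->.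
rewrite leq_eqVlt => /orP[/eqP->//|Nm].
by rewrite YS hs// subrr mul0r scale0r addr0 IH.
Qed.

(** The stabilized value of [Y n x]; by [Psi_eq] the selected index is immaterial. The default 0
    concerns only points that never settle, where [r x = 0]. *)
Definition Psi x : E := Y (xget 0%N [set N | settled N x]) x.

Lemma Psi_eq N x : settled N x -> Psi x = Y N x.
Proof.
move=> h; rewrite /Psi; have := xgetPex 0%N (ex_intro [set N | settled N x] N h).
set M := xget _ _ => hM.
by case/orP: (leq_total N M) => NM; [apply: settled_Y|apply/esym/settled_Y].
Qed.

Lemma settled_of N x : 4 * Q N x <= r x * r x -> settled N x.
Proof.
move=> h n Nn; apply: (w_eq1 (close_self (x := x))).
by apply: le_trans h; rewrite ler_pM2l// Q_mono.
Qed.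

Lemma Q_small x (ep : R) : 0 < ep -> exists N, forall n, (N <= n)%N -> Q n x < ep.
Proof.
move=> ep0; pose d := Num.min 1 (ep / 2).
have d0 : 0 < d by rewrite lt_min ltr01 divr_gt0.
have d1 : d <= 1 by rewrite ge_min lexx.
have d2 : d <= ep / 2 by rewrite ge_min lexx orbT.
have [N1 h1] := expr2V_lt d0; have [N3 h2] := Tn_small hB x d0.
exists (maxn N1 N3) => n; rewrite geq_max => /andP[/h1 a1 /h2 a2].
have b1 : dyadic n * dyadic n < d * 1.
  by apply: ltr_pM; rewrite ?(ltW (dyadic_gt0 n))//; apply: lt_le_trans d1.
have b2 : `|Tn n x| * `|Tn n x| < d * 1 by apply: ltr_pM => //; apply: lt_le_trans d1.
rewrite /Q /N2; lra.
Qed.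

(** The constant stays free because 1/4 is used to settle the weights and 1/64 to compare
    coefficients at critical points. Near [x] the tail part reaches at most three quarters of
    [c * (r x * r x)], while [r y * r y] keeps three quarters of [r x * r x]. *)
Lemma near_settled x (c : R) : 0 < c -> 0 < r x ->
  exists N, exists2 V, nbhs x V & forall y, V y -> 0 < r y /\ Q N y <= c * (r y * r y).
Proof.
move=> c0 rx; have d0 : 0 < c * (r x * r x) / 2 by rewrite divr_gt0// !mulr_gt0.
have [N /(_ N (leqnn N)) hN1] := Q_small x d0.
exists N.
have rr := sder_mul (rD x) (rD x).
have dd0 : 0 < r x * r x / 4 by rewrite divr_gt0// mulr_gt0.
have d4 : 0 < c * (r x * r x) / 4 by rewrite divr_gt0// !mulr_gt0.
exists ([set y | `|r x * r x - r y * r y| < r x * r x / 4] `&`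
  ([set y | `|Q N x - Q N y| < c * (r x * r x) / 4] `&` [set y | `|r x - r y| < r x])).
  apply: filterI; first by have /cvgrPdist_lt := sder_cont rr; apply.
  apply: filterI; first by have /cvgrPdist_lt := sder_cont (Q_sder N x); apply.
  by have /cvgrPdist_lt := sder_cont (rD x); apply.
move=> y [/= h1 [/= h2 /= h3]]; split.
  by move: h3; rewrite ltr_norml; lra.
move: h1 h2; rewrite !ltr_norml => /andP[h1 h1'] /andP[h2 h2'].
have : c * (r x * r x) * (3 / 4) <= c * (r y * r y) by rewrite -mulrA ler_pM2l//; lra.
lra.
Qed.

Lemma Psi_near x : 0 < r x -> exists N, exists2 V, nbhs x V &
  forall y, V y -> [/\ 0 < r y, settled N y & Psi y = Y N y].
Proof.
move=> rx; have c0 : 0 < 4^-1 :> R by rewrite invr_gt0.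
have [N [V hV h]] := near_settled c0 rx.
exists N, V => // y /h[ry hQ]; have hs : settled N y by apply: settled_of; lra.
by split => //; exact: Psi_eq.
Qed.

Lemma Psi_sder N x : 0 < r x -> settled N x -> sder Psi x (DY N x).
Proof.
move=> rx hs; have [M [V hV h]] := Psi_near rx.
have h1 : sder Psi x (DY M x).
  by apply: (sder_near (Y_sder M x)); exists V => // y /h[].
suff -> : DY N x = DY M x by [].
(* At weight 1 both [1 - w] and [Dw] vanish, so [DY] stops changing. *)
have key P P' : settled P x -> (P <= P')%N -> DY P' x = DY P x.
  move=> hP; elim: P' => [|P' IH]; first by rewrite leqn0 => /eqP->.
  rewrite leq_eqVlt => /orP[/eqP->//|PP]; rewrite -IH//.
  apply/funext => v; rewrite DYS (hP _ PP) subrr mul0r /Dw (chi1_dchi0 (hP _ PP)).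
  by rewrite mul0r mulr0 subrr scale0r addr0.
have [_ hM _] := h x (nbhs_singleton hV).
by case/orP: (leq_total N M) => NM; [apply/esym/key|apply: key].
Qed.

Lemma settled_loud N x : settled N x -> exists i, [/\ (i <= N)%N, quiet i x & w i x != 0].
Proof.
move=> hs; have nq : ~ quiet N.+1 x.
  by move=> /(_ N (ltnSn N)); rewrite hs// => /eqP; rewrite oner_eq0.
by have [i [iN qi wi]] := loud_first nq; exists i.
Qed.

Lemma Dr_bound x v : `|Dr x v| <= 256^-1 * `|v|.
Proof.
by apply: (sder_bound (rD x)); exists setT; [exact: filterT|move=> y _; exact: rlip].
Qed.

(* Where [dchi] is nonzero, [t^2 / 2 < Q j x < t^2] with [t = r (Y j x)]. *)
Lemma Dw_bound i j x v : quiet i x -> w i x != 0 -> (i <= j)%N ->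
  `|DY j x v| <= 80 * `|v| -> r (Y i x) * `|Dw j x v| <= 38 * `|v|.
Proof.
move=> qi wi ij hD; have [wj|wj] := eqVneq (dchi (sq j x)) 0.
  by rewrite /Dw wj mul0r normr0 mulr0 mulr_ge0.
have /andP[s1 s2] := dchi_neq0 wj.
have /andP[c0 c4] := dchi_bounds (sq j x).
set t := r (Y j x); have Qj := Q_gt0 j x.
have s1' : Q j x < t * t by move: s1; rewrite /sq ltr_pdivlMr// mul1r.
have s2' : t * t < 2 * Q j x by move: s2; rewrite /sq ltr_pdivrMr.
have t0 : 0 <= t := r0 _.
have Tt : `|Tn j x| < t by apply: sqr_lt_of s1' => //; exact: Tn_Q.
have tp : 0 < t by apply: le_lt_trans Tt.
have ti : 127 / 128 * r (Y i x) <= t.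
  have := r_close qi wi (Y_close qi (leqnn i)) (Y_close qi ij).
  by rewrite -/t ler_norml; lra.
have h1 : `|2 * t * Dr (Y j x) (DY j x v) / Q j x| * t <= 4 * (80 / 256) * `|v|.
  rewrite !normrM (ger0_norm t0) normr_nat (gtr0_norm (_ : 0 < (Q j x)^-1)) ?invr_gt0//.
  have h2 := le_trans (Dr_bound (Y j x) (DY j x v)) (ler_wpM2l (_ : 0 <= 256^-1) hD).
  have {}h2 := h2 (ltW (_ : 0 < 256^-1)).
  have q2 : t * t / Q j x <= 2 by rewrite ler_pdivrMr// ltW.
  have -> : 2 * t * `|Dr (Y j x) (DY j x v)| / Q j x * t =
    2 * (t * t / Q j x) * `|Dr (Y j x) (DY j x v)| by ring.
  have -> : 4 * (80 / 256) * `|v| = 2 * 2 * (256^-1 * (80 * `|v|)) by field.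
  apply: ler_pM => //.
  - by rewrite !mulr_ge0// invr_ge0 ltW.
  - by rewrite ler_pM2l.
  - by apply: h2; rewrite invr_gt0.
have h2 : `|t * t / (Q j x * Q j x) * G (Tn j x) (Tn j v)| * t <= 8 * `|v|.
  rewrite normrM ger0_norm; last by rewrite !mulr_ge0// invr_ge0 mulr_ge0// ltW.
  have hG := G_bound hN (Tn j x) (Tn j v).
  have hT : `|Tn j v| <= `|v| := Tn_contr hB j v.
  have hG2 : `|G (Tn j x) (Tn j v)| <= 2 * t * `|v|.
    apply: (le_trans hG); apply: ler_pM => //.
    by rewrite ler_pM2l// ltW.
  have q2 : t * t / Q j x <= 2 by rewrite ler_pdivrMr// ltW.
  have q0 : 0 <= t * t / Q j x by rewrite !mulr_ge0// invr_ge0 ltW.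
  have q4 : (t * t / Q j x) * (t * t / Q j x) <= 2 * 2 by apply: ler_pM.
  have : t * t / (Q j x * Q j x) * `|G (Tn j x) (Tn j v)| * t <=
     t * t / (Q j x * Q j x) * (2 * t * `|v|) * t.
    apply: ler_wpM2r => //; apply: ler_wpM2l => //.
    by rewrite !mulr_ge0// invr_ge0 mulr_ge0// ltW.
  have -> : t * t / (Q j x * Q j x) * (2 * t * `|v|) * t =
     ((t * t / Q j x) * (t * t / Q j x)) * (2 * `|v|).
    by field; rewrite gt_eqF.
  move=> h; apply: (le_trans h).
  have -> : 8 * `|v| = (2 * 2) * (2 * `|v|) by ring.
  by apply: ler_wpM2r => //; rewrite mulr_ge0.
(* The leading 4 bounds [dchi], and the constant is 37 in total. Passing from [t] to [r (Y i x)]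
   costs a factor [128 / 127], which stays below 38. *)
have h3 : `|Dw j x v| * t <= 4 * ((4 * (80 / 256) + 8) * `|v|).
  rewrite /Dw normrM (ger0_norm c0) -(mulrA (dchi (sq j x))); apply: ler_pM => //.
  - by rewrite mulr_ge0.
  - apply: le_trans (ler_wpM2r t0 (ler_normB _ _)) _.
    by rewrite [leLHS]mulrDl [leRHS]mulrDl; apply: lerD; [exact: h1|exact: h2].
have h4 : 127 / 128 * r (Y i x) * `|Dw j x v| <= t * `|Dw j x v| by apply: ler_wpM2r.
have := normr_ge0 v; move: h3 h4; rewrite [t * _]mulrC; lra.
Qed.

(** There are three sources of error: the truncation at [m], the damping of the coordinates of [v],
    and the variation of the weights, which acts on the coordinates of [x]. Vanishing weights have
    vanishing derivatives, which justifies the masks. *)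
Lemma DY_eq n m x v : quiet n x -> (n <= m)%N ->
  v - DY m x v = Tn m v + \sum_(i < m) (if (i < n)%N then 0 else w i x) *: (co v i *: e i)
    + \sum_(i < m) (if (i < n)%N then 0 else Dw i x v) *: (co x i *: e i).
Proof.
move=> qn; elim: m => [|m IH] nm.
  by rewrite !big_ord0 /= Tn0 subr0 !addr0.
have Dz i : (i < n)%N -> Dw i x v = 0.
  by move=> /qn /chi0_dchi0 h; rewrite /Dw h mul0r.
have {}IH : v - DY m x v = Tn m v + \sum_(i < m) (if (i < n)%N then 0 else w i x) *: (co v i *: e i)
    + \sum_(i < m) (if (i < n)%N then 0 else Dw i x v) *: (co x i *: e i).
  move: nm; rewrite leq_eqVlt => /orP[/eqP nm|/IH//].
  have h1 : DY m x v = Sn m v.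
    have : (m <= n)%N by rewrite nm.
    elim: m {IH nm} => [|m IHm] mn; first by rewrite Sn0.
    by rewrite DYS SnS IHm 1?ltnW// qn// Dz// subr0 mul1r mulr0 subr0.
  rewrite h1 !big1 ?addr0// => i _; rewrite nm (ltn_trans (ltn_ord i) (ltnSn m)) scale0r//.
have E1 : (if (m < n)%N then 0 else w m x) = w m x by case: ifP => // /qn->.
have E2 : (if (m < n)%N then 0 else Dw m x v) = Dw m x v by case: ifP => // /Dz->.
rewrite !big_ord_recr /= E1 E2 -/(w m x) -/(Dw m x v) opprD addrA IH TnS.
have -> : ((1 - w m x) * co v m - co x m * Dw m x v) *: e m =
   co v m *: e m - w m x *: (co v m *: e m) - Dw m x v *: (co x m *: e m).
  by rewrite !scalerA -!scalerBl; congr (_ *: _); ring.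
rewrite !opprB [X in _ = X + _]addrACA [RHS]addrACA.
by congr (_ + _); rewrite addrC; congr (_ + _); rewrite addrC.
Qed.

(* A bound [80] on the earlier derivatives reproduces itself: [1 + 1 + 2 * 38 <= 79]. *)
Lemma DY_bound i m x v : quiet i x -> w i x != 0 -> `|v - DY m x v| <= 79 * `|v| /\ `|DY m x v| <= 80 * `|v|.
Proof.
move=> qi wi; elim/ltn_ind: m => m IH.
suff h : `|v - DY m x v| <= 79 * `|v|.
  split => //; rewrite -[DY m x v](subKr v) (le_trans (ler_normB _ _))//; lra.
have nv := normr_ge0 v.
have [im|mi] := leqP i m; last first.
  have qm : quiet m x by move=> j jm; apply: qi; exact: ltn_trans mi.
  rewrite (DY_eq v qm (leqnn m)) !big1 ?addr0; last 2 first.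
  - by move=> j _; rewrite ltn_ord scale0r.
  - by move=> j _; rewrite ltn_ord scale0r.
  by apply: (le_trans (Tn_contr hB _ _)); lra.
rewrite (DY_eq v qi im).
have h1 := Tn_contr hB m v.
have h2 : `|\sum_(j < m) (if (j < i)%N then 0 else w j x) *: (co v j *: e j)| <= `|v|.
  apply: (mult_contr2 hB (s := fun j => if (j < i)%N then 0 else w j x)) => j.
  by case: ifP => _; [lra|exact: w01].
have [_ wi'] := w_neq0 wi; have ri : 0 < r (Y i x) by apply: le_lt_trans wi'.
have h3 : `|\sum_(j < m) (if (j < i)%N then 0 else Dw j x v) *: (co x j *: e j)| <= 76 * `|v|.
  have B0 : 0 <= 38 * `|v| / r (Y i x) by rewrite divr_ge0// mulr_ge0.
  have h := @mult_signed R E e hB (fun j => if (j < i)%N || (m <= j)%N then 0 else Dw j x v) _ x i m B0.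
  have h4 : `|\sum_(j < m) (if (j < i)%N || (m <= j)%N then 0 else Dw j x v) *: (co x j *: e j)| <=
      2 * (38 * `|v| / r (Y i x)) * `|Tn i x|.
    apply: h => j ij; last by rewrite ij.
    case: ifP => [_|/norP[_]]; first by rewrite normr0.
    rewrite -ltnNge => jm; rewrite ler_pdivlMr// mulrC.
    by apply: Dw_bound => //; have [] := IH j jm.
  apply: le_trans (_ : _ <= 2 * (38 * `|v| / r (Y i x)) * `|Tn i x|) _.
    apply: le_trans h4; rewrite le_eqVlt; apply/orP; left; apply/eqP; congr (`|_|).
    by apply: eq_bigr => j _; rewrite [(m <= j)%N]leqNgt ltn_ord orbF.
  have -> : 2 * (38 * `|v| / r (Y i x)) * `|Tn i x| = 76 * `|v| * (`|Tn i x| / r (Y i x)).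
    by field; rewrite gt_eqF.
  by rewrite ler_piMr ?mulr_ge0// ler_pdivrMr// mul1r ltW.
rewrite (le_trans (ler_normD _ _))// (le_trans (lerD (ler_normD _ _) h3))//; lra.
Qed.

(** The correction is thus a tail vector, on which [Df] is small because the basis is shrinking. *)
Lemma DY_range i m x v : quiet i x -> (i <= m)%N -> Tn i (v - DY m x v) = v - DY m x v.
Proof.
move=> qi im; rewrite /Tn (_ : Sn i _ = 0) ?subr0//.
apply: big1 => j _; rewrite (DY_eq v qi im) (coD hB (_ + _)) (coD hB (Tn m v)) co_Tn// (leq_trans (ltn_ord j) im) add0r.
rewrite !co_sum// !big1 ?addr0 ?scale0r// => k _; rewrite !coZ// co_e//.
  by case: eqP => [<-|]; rewrite ?ltn_ord ?mul0r ?mulr0.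
by case: eqP => [<-|]; rewrite ?ltn_ord ?mul0r ?mulr0.
Qed.

(** Everything is measured at the first index [i] of nonzero weight: the tail there is smaller than
    the radius, and all radii involved are comparable. *)
Lemma Psi_facts x : 0 < r x -> exists N i, [/\ settled N x, sder Psi x (DY N x),
   (forall v, `|v - DY N x v| <= 79 * `|v|), (forall v, `|DY N x v| <= 80 * `|v|) &
   [/\ (forall v, Tn i (v - DY N x v) = v - DY N x v), dyadic i <= 2 * r x, `|x - Psi x| <= 2 * r x,
     r (Psi x) <= 2 * r x & r x <= 2 * r (Psi x)]].
Proof.
move=> rx; have [N [V hV h]] := Psi_near rx.
have [_ hs hP] := h x (nbhs_singleton hV).
have [i [iN qi wi]] := settled_loud hs.
have [h1 h2] := w_neq0 wi.
have c1 : `|x - x| <= `|Tn i x| by rewrite subrr normr0.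
have cP : `|x - Psi x| <= `|Tn i x| by rewrite hP; apply: Y_close.
have cY := Y_close qi (leqnn i).
have k1 := r_ratio qi wi cY c1; have k2 := r_ratio qi wi cP c1.
have k3 := r_ratio qi wi c1 cP.
have := r0 (Y i x); have := r0 (Psi x).
exists N, i; split => //; first exact: Psi_sder.
- by move=> v; have [] := DY_bound N v qi wi.
- by move=> v; have [] := DY_bound N v qi wi.
split; [by move=> v; exact: DY_range| lra..].
Qed.

End CutMap.

(** * The perturbation *)

Section Perturbation.
Variables (R : realType) (E : completeNormedModType R) (e : nat -> E).
Hypothesis hB : one_suppression_unconditional e.
Hypothesis hN : norm_C1_away_from_0 E.
Variables (r : E -> R) (Dr : E -> E -> R).
Hypothesis rD : forall x, sder r x (Dr x).
Hypothesis r0 : forall x, 0 <= r x.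
Hypothesis r1 : forall x, r x <= 1.
Hypothesis rlip : forall x y, `|r x - r y| <= 256^-1 * `|x - y|.

Local Notation co := (co e).
Local Notation Tn := (Tn e).
Local Notation Q := (Q e).
Local Notation Psi := (Psi e r).
Local Notation DY := (DY e r Dr).
Local Notation Y := (Y e r).
Local Notation w := (w e r).
Local Notation settled := (settled e r).

(** The factor 1/4 matches [w_eq1]: at settled points a positive margin at [n] forces weight 1 from
    [n] on. *)
Definition margin (n : nat) (x : E) : R := r (Psi x) * r (Psi x) / 4 - Q n x.
(** The ratio 1/8 lets one term outweigh all later ones in [dominance]. *)
Definition wt (d a n : nat) : R := if (n %% d)%N == a then (8^-1) ^+ n else 0.
Definition pert_term d a n x : R := wt d a n * psq (margin n x).
Definition Dpert_term d a n x (A : E -> E) v : R :=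
  wt d a n * (2 * ppos (margin n x) * (r (Psi x) * Dr (Psi x) (A v) / 2 - G (Tn n x) (Tn n v))).
Definition pert d a x : R := gsum (fun n => pert_term d a n x).
Definition Dpert d a x A v : R := gsum (fun n => Dpert_term d a n x A v).

Lemma wt_bound d a n : 0 <= wt d a n <= (2^-1) ^+ n.
Proof.
rewrite /wt; case: ifP => _.
  rewrite exprn_ge0 ?invr_ge0//= lerXn2r ?nnegrE ?invr_ge0//.
  by rewrite lef_pV2 ?posrE// ler_nat.
by rewrite lexx ltW// half_gt0.
Qed.

Lemma rP_sq x : 0 <= r (Psi x) * r (Psi x) <= 1.
Proof. by rewrite mulr_ge0//= -[leRHS]mulr1; apply: ler_pM. Qed.

Lemma ppos_margin n x : ppos (margin n x) <= r (Psi x) * r (Psi x) / 4.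
Proof.
have /andP[h _] := rP_sq x; have hQ := ltW (Q_gt0 e n x).
case: (pposE (margin n x)) => [[_ ->]|[_ ->]]; rewrite /margin; lra.
Qed.

Lemma psq_lip1 (a b : R) : ppos a <= 1 -> ppos b <= 1 -> `|psq a - psq b| <= 2 * `|a - b|.
Proof.
move=> a1 b1; have -> : psq a - psq b = (ppos a + ppos b) * (ppos a - ppos b) by rewrite /psq; ring.
rewrite normrM ger0_norm ?addr_ge0 ?ppos_ge0//; apply: ler_pM => //.
- by rewrite addr_ge0 ?ppos_ge0.
- lra.
- exact: ppos_lip.
Qed.

Lemma margin_sder N n x : 0 < r x -> settled N x ->
  sder (margin n) x (fun v => r (Psi x) * Dr (Psi x) (DY N x v) / 2 - G (Tn n x) (Tn n v)).
Proof.
move=> rx hs; have h1 := sder_comp (Psi_sder hB hN rD r0 rlip rx hs) (rD (Psi x)).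
have h2 := sder_comp (sder_mul h1 h1) (sder_lin _ (blin_mulr 4^-1 (blin_id R))).
have h3 := sder_add h2 (sder_comp (Q_sder hB hN n x) (sder_lin _ (blin_opp (blin_id R)))).
by apply: (sder_eqd h3) => v /=; field.
Qed.

Lemma pert_term_sder d a N n x : 0 < r x -> settled N x -> sder (pert_term d a n) x (Dpert_term d a n x (DY N x)).
Proof.
move=> rx hs; have h1 := sder_comp (margin_sder n rx hs) (sder_psq (margin n x)).
exact: (sder_comp h1 (sder_lin _ (blin_mul (wt d a n) (blin_id R)))).
Qed.

Lemma Q_lip n y z : `|Q n y - Q n z| <= (`|y| + `|z|) * `|y - z|.
Proof.
rewrite /Q opprD addrACA subrr add0r (le_trans (N2_lip _ _))//.
rewrite -(blinB (blin_Tn hB n)); apply: ler_pM => //.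
- by apply: lerD; exact: Tn_contr.
- exact: Tn_contr.
Qed.

Lemma pert_sder d a N x : 0 < r x -> settled N x -> sder (pert d a) x (Dpert d a x (DY N x)).
Proof.
move=> rx hs.
have h1 := sder_comp (Psi_sder hB hN rD r0 rlip rx hs) (rD (Psi x)).
have [K K0 [V hV hK]] := sder_lip (sder_comp (sder_mul h1 h1) (sder_lin _ (blin_mulr 4^-1 (blin_id R)))).
have nx := normr_ge0 x.
have pa n y : ppos (margin n y) <= 1.
  by have := ppos_margin n y; have := rP_sq y; lra.
(* On the unit ball around [x] the functions [Q n] share a Lipschitz constant, and [K] serves the
   radius part. A single constant has to bound the terms as well as their increments, hence the
   final [+ 1]. *)
apply: (@sder_series _ _ (pert_term d a) x _ (V `&` [set y | `|y - x| < 1]) (2 * (K + 2 * (`|x| + 1)) + 1)).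
- by apply: filterI => //; exact: nbhs_ballr.
- move=> y _ n; have /andP[w1 w2] := wt_bound d a n.
  rewrite /pert_term normrM ger0_norm// ger0_norm ?psq_ge0//.
  have : psq (margin n y) <= 1 by rewrite /psq expr_le1 ?ppos_ge0.
  move=> p1; have h : wt d a n * psq (margin n y) <= (2^-1) ^+ n * 1.
    by apply: ler_pM => //; exact: psq_ge0.
  apply: (le_trans h); rewrite mulrC; apply: ler_wpM2r; last lra.
  by rewrite ltW// half_gt0.
- move=> y z [Vy /= hy] [Vz /= hz] n; have /andP[w1 w2] := wt_bound d a n.
  rewrite /pert_term -mulrBr normrM ger0_norm// [leRHS]mulrC; apply: ler_pM => //.
  apply: (le_trans (psq_lip1 (pa n y) (pa n z))).
  have h2 := hK y z Vy Vz; have h3 := Q_lip n y z.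
  have ny : `|y| <= `|x| + 1 by have := ler_normD (y - x) x; rewrite subrK; lra.
  have nz : `|z| <= `|x| + 1 by have := ler_normD (z - x) x; rewrite subrK; lra.
  have h4 : (`|y| + `|z|) * `|y - z| <= (2 * (`|x| + 1)) * `|y - z|.
    by apply: ler_wpM2r => //; lra.
  have : `|margin n y - margin n z| <= (K + 2 * (`|x| + 1)) * `|y - z|.
    have -> : margin n y - margin n z =
      (r (Psi y) * r (Psi y) / 4 - r (Psi z) * r (Psi z) / 4) - (Q n y - Q n z).
      by rewrite /margin; ring.
    rewrite (le_trans (ler_normB _ _))// mulrDl; apply: lerD => //; exact: le_trans h3 h4.
  have := normr_ge0 (y - z); lra.
- by move=> n; exact: pert_term_sder.
Qed.

Lemma pert_bound d a x : r (Psi x) <= 2 * r x -> `|pert d a x| <= r x.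
Proof.
move=> h; have /andP[q0 q1] := rP_sq x.
have g : geo (r x / 8) (fun n => pert_term d a n x).
  move=> n; have /andP[w1 w2] := wt_bound d a n.
  rewrite /pert_term normrM ger0_norm// ger0_norm ?psq_ge0// mulrC; apply: ler_pM => //.
    exact: psq_ge0.
  have p := ppos_margin n x; have p0 := ppos_ge0 (margin n x).
  have h1 : psq (margin n x) <= r (Psi x) * r (Psi x) / 4 * 4^-1.
    by rewrite /psq expr2; apply: ler_pM => //; lra.
  have h2 : r (Psi x) * r (Psi x) <= r (Psi x) * 1 by apply: ler_wpM2l.
  lra.
by have := gsum_norm g; have := r0 x; rewrite /pert; lra.
Qed.

(** Only indices with nonnegative margin contribute; there the tail is at most [r (Psi x) / 2], so
    the gradient term is of the order of the radius. *)
Lemma Dpert_bound d a x (A : E -> E) v : `|A v| <= 80 * `|v| -> r (Psi x) <= 2 * r x ->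
  `|Dpert d a x A v| <= 4 * r x * `|v|.
Proof.
move=> hA h; have nv := normr_ge0 v; have rp := r0 (Psi x); have rp1 := r1 (Psi x).
suff g : geo (2 * r x * `|v|) (fun n => Dpert_term d a n x A v).
  by have := gsum_norm g; rewrite /Dpert; lra.
move=> n; have /andP[w1 w2] := wt_bound d a n.
rewrite /Dpert_term normrM ger0_norm// mulrC; apply: ler_pM => //.
case: (pposE (margin n x)) => [[ha ->]|[_ ->]]; last first.
  by rewrite mulr0 mul0r normr0 !mulr_ge0.
have hQ : Q n x <= (r (Psi x) / 2) * (r (Psi x) / 2) by move: ha; rewrite /margin; lra.
have hT : `|Tn n x| <= r (Psi x) / 2.
  by apply: sqr_le_of hQ; [rewrite divr_ge0|exact: Tn_Q].
have hG : `|G (Tn n x) (Tn n v)| <= r (Psi x) * `|v|.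
  apply: (le_trans (G_bound hN _ _)); apply: ler_pM => //; first by lra.
  exact: Tn_contr.
have hD : `|r (Psi x) * Dr (Psi x) (A v) / 2| <= r (Psi x) * `|v|.
  rewrite !normrM (ger0_norm rp) normrV ?unitfE// normr_nat -mulrA; apply: ler_wpM2l => //.
  have := Dr_bound rD rlip (Psi x) (A v); lra.
rewrite normrM ger0_norm ?mulr_ge0//.
have hs : `|r (Psi x) * Dr (Psi x) (A v) / 2 - G (Tn n x) (Tn n v)| <= 2 * r x * `|v| * 2.
  apply: (le_trans (ler_normB _ _)).
  have : r (Psi x) * `|v| <= 2 * r x * `|v| by apply: ler_wpM2r.
  lra.
have ha2 : margin n x <= 4^-1.
  by have := ppos_margin n x; rewrite ppos_id//; have := rP_sq x; lra.
have hb : 2 * margin n x * `|r (Psi x) * Dr (Psi x) (A v) / 2 - G (Tn n x) (Tn n v)| <=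
   2^-1 * (2 * r x * `|v| * 2).
  by apply: ler_pM => //; [rewrite mulr_ge0|lra].
by apply: (le_trans hb); lra.
Qed.

(* The coordinates below [k] are found by descending recursion; the pivot is positive because
   [co y n * G (Tn n y) (e n) >= 0]. *)
Lemma kill_vector k y : w k y = 1 -> exists v, [/\ (forall m, (k < m)%N -> co v m = 0),
  co v k = 1, (forall m, (m < k)%N -> w m y = 1 -> co v m = 0) & (forall n, DY n y v = 0)].
Proof.
move=> wk.
pose kap m := dchi (sq e r m y) * (r (Y m y) * r (Y m y) / (Q m y * Q m y)).
have kap0 m : 0 <= kap m.
  have /andP[c0 _] := dchi_bounds (sq e r m y).
  by rewrite mulr_ge0// mulr_ge0 ?mulr_ge0// invr_ge0 mulr_ge0// ltW// Q_gt0.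
have kapw m : w m y = 1 -> kap m = 0 by move=> /chi1_dchi0 h; rewrite /kap h mul0r.
suff [v [v1 v2 v3]] : exists v, [/\ (forall m, (k < m)%N -> co v m = 0), co v k = 1 &
    forall m, (m < k)%N -> (w m y = 1 -> co v m = 0) /\
     (1 - w m y) * co v m + co y m * (kap m * G (Tn m y) (Tn m v)) = 0].
  exists v; split => //; first by move=> m /v3[].
  (* Once the earlier stages vanish on [v], the [Dr] term drops out of [Dw], and stage [n] becomes a
     scalar equation for coordinate [n] in terms of the tail. *)
  elim=> [//|n IH]; rewrite DYS IH add0r.
  have -> : Dw e r Dr n y v = - (kap n * G (Tn n y) (Tn n v)).
    by rewrite /Dw IH (blin0 (sder_blin (rD _))) mulr0 mul0r sub0r mulrN mulrA.
  rewrite mulrN opprK.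
  suff -> : (1 - w n y) * co v n + co y n * (kap n * G (Tn n y) (Tn n v)) = 0 by rewrite scale0r.
  case: (ltngtP n k) => [/v3[]//|kn|->].
    have T0 : Tn n v = 0.
      by apply: (Tn_eq0 hB) => i ni; apply: v1; exact: leq_trans ni.
    by rewrite T0 (blin0 (blin_G hN _)) v1// !mulr0 addr0.
  by rewrite wk kapw// subrr !mul0r mulr0 addr0.
(* After [j] steps the coordinates from [k - j] on are final. A coordinate [n] added later does not
   disturb the equations at [m > n], because [Tn m (e n) = 0]. *)
have key j : (j <= k)%N -> exists v, [/\ (forall m, (k < m)%N -> co v m = 0), co v k = 1,
    (forall m, (m < k - j)%N -> co v m = 0) &
    forall m, (k - j <= m < k)%N -> (w m y = 1 -> co v m = 0) /\
     (1 - w m y) * co v m + co y m * (kap m * G (Tn m y) (Tn m v)) = 0].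
  elim: j => [|j IH] jk.
    exists (e k); rewrite subn0; split.
    - by move=> m km; rewrite co_e// gtn_eqF.
    - by rewrite co_e// eqxx.
    - by move=> m mk; rewrite co_e// ltn_eqF.
    - by move=> m /andP[h1]; rewrite ltnNge h1.
  have [v [v1 v2 v3 v4]] := IH (ltnW jk).
  pose n := (k - j.+1)%N.
  have nS : n.+1 = (k - j)%N by rewrite /n subnS prednK// subn_gt0.
  have nk : (n < k)%N by rewrite nS leq_subr.
  pose den := (1 - w n y) + co y n * (kap n * G (Tn n y) (e n)).
  pose num := co y n * (kap n * G (Tn n y) (Tn n v)).
  pose c := - num / den.
  pose v' := v + c *: e n.
  have cv m : co v' m = if m == n then c else co v m.
    rewrite /v' coD// coZ// co_e//; case: eqP => [->|_]; last by rewrite mulr0 addr0.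
    by rewrite mulr1 v3 ?add0r// -nS.
  have den0 : 0 <= co y n * (kap n * G (Tn n y) (e n)).
    rewrite mulrCA; apply: mulr_ge0 => //.
    by have := G_co_ge0 hB hN (Tn n y) n; rewrite co_Tn// ltnn.
  exists v'; split.
  - by move=> m km; rewrite cv gtn_eqF ?v1//; exact: ltn_trans km.
  - by rewrite cv gtn_eqF.
  - move=> m mn; rewrite cv ltn_eqF ?v3//; rewrite -nS; exact: ltn_trans (ltnSn n).
  move=> m /andP[nm mk]; rewrite cv; case: eqP => [->|/eqP mn].
    have Tv' : Tn n v' = Tn n v + c *: e n.
      rewrite (blinD (blin_Tn hB n)) (blinZ (blin_Tn hB n)); congr (_ + _ *: _).
      rewrite /Tn /Sn big1 ?subr0// => i _; rewrite co_e// ltn_eqF// scale0r//.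
    have [w1|w1] := eqVneq (w n y) 1.
      have c0 : c = 0 by rewrite /c /num (kapw _ w1) !(mul0r, mulr0) oppr0 mul0r.
      by rewrite c0 (kapw _ w1) !(mul0r, mulr0) addr0.
    split; first by move=> h; rewrite h eqxx in w1.
    rewrite Tv' (blinD (blin_G hN _)) (blinZr (blin_G hN _)).
    have den1 : den != 0.
      rewrite gt_eqF// /den ltr_wpDr// subr_gt0 lt_neqAle w1/=.
      by have /andP[] := w01 e r n y.
    have -> : (1 - w n y) * c + co y n * (kap n * (G (Tn n y) (Tn n v) + c * G (Tn n y) (e n))) =
      den * c + num by rewrite /den /num; ring.
    by rewrite /c mulrC divfK// addNr.
  have nm' : (n < m)%N by rewrite ltn_neqAle eq_sym mn.
  have Tv' : Tn m v' = Tn m v.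
    rewrite (blinD (blin_Tn hB m)) (blinZ (blin_Tn hB m)).
    suff -> : Tn m (e n) = 0 by rewrite scaler0 addr0.
    rewrite /Tn /Sn (bigD1 (Ordinal nm'))//= co_e// eqxx scale1r big1 ?addr0 ?subrr//.
    by move=> i; rewrite -val_eqE /= => ni; rewrite co_e// (negbTE ni) scale0r.
  by rewrite Tv'; apply: v4; rewrite -nS nm' mk.
have [v [v1 v2 _ v4]] := key k (leqnn k).
by exists v; split => // m mk; apply: v4; rewrite subnn.
Qed.

End Perturbation.

(** * Relations at critical points *)

Section CriticalRelations.
Variables (R : realType) (E : completeNormedModType R) (e : nat -> E).
Hypothesis hB : one_suppression_unconditional e.
Hypothesis hN : norm_C1_away_from_0 E.
Hypothesis hS : strictly_convex_norm E.
Variables (r : E -> R) (Dr : E -> E -> R).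
Hypothesis rD : forall x, sder r x (Dr x).
Hypothesis r0 : forall x, 0 <= r x.
Hypothesis rlip : forall x y, `|r x - r y| <= 256^-1 * `|x - y|.

Local Notation co := (co e).
Local Notation Tn := (Tn e).
Local Notation Q := (Q e).
Local Notation Psi := (Psi e r).
Local Notation DY := (DY e r Dr).
Local Notation Y := (Y e r).
Local Notation w := (w e r).
Local Notation settled := (settled e r).
Local Notation margin := (margin e r).

(** Up to sign, the factor of [G (Tn n y) (e k)] when [lam] is applied to the derivative of the
    perturbation along a killed direction. Indexing [lam] by [nat] allows evaluation at [n %% d]. *)
Definition crit_coef d (lam : nat -> R) y n : R := lam (n %% d)%N * (8^-1) ^+ n * (2 * ppos (margin n y)).

(** The point [Psi y] equals [Y M y] for every large [M]; taking [M] at least [j] makes it an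
    admissible comparison point in [w_eq1]. *)
Lemma margin_w N n j y : settled N y -> 0 < margin n y -> (n <= j)%N -> w j y = 1.
Proof.
move=> hs ha nj; pose M := maxn N j.
have hP : Psi y = Y M y.
  by rewrite (Psi_eq hs) -(settled_Y hs (leq_maxl N j)).
apply: (w_eq1 hB r0 rlip (z := Psi y)).
  by rewrite hP; apply: close_Y => //; exact: leq_maxr.
by have := Q_mono hB y nj; move: ha; rewrite /margin; lra.
Qed.

Lemma sum_wt d (lam : nat -> R) n : (0 < d)%N ->
  \sum_(a < d) lam a * wt R d a n = lam (n %% d)%N * (8^-1) ^+ n.
Proof.
move=> d0; rewrite (bigD1 (Ordinal (ltn_pmod n d0)))//= {1}/wt eqxx big1 ?addr0// => i.
by rewrite -val_eqE /= eq_sym /wt => /negbTE->; rewrite mulr0.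
Qed.

(** If [w k y = 1], the relation comes from the killed direction with leading coordinate [k].
    Otherwise no margin up to [k] is positive, and all coefficients vanish. *)
Lemma crit_rel d (lam : nat -> R) N y : (0 < d)%N -> settled N y ->
  (forall v, (forall n, DY n y v = 0) ->
     \sum_(a < d) lam a * Dpert e r Dr d a y (DY N y) v = 0) ->
  forall k, \sum_(n < k.+1) crit_coef d lam y n * G (Tn n y) (e k) = 0.
Proof.
move=> d0 hs hD k; have [wk|wk] := eqVneq (w k y) 1; last first.
  apply: big1 => n _; rewrite /crit_coef; case: (pposE (margin n y)) => [[h ->]|[_ ->]]; last first.
    by rewrite !(mulr0, mul0r).
  have [->|a0] := eqVneq (margin n y) 0; first by rewrite !(mulr0, mul0r).
  have ap : 0 < margin n y by rewrite lt_def a0.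
  have nk : (n <= k)%N by rewrite -ltnS.
  by move: wk; rewrite (margin_w hs ap nk) eqxx.
have [v [v1 v2 v3 v4]] := kill_vector hB hN rD r0 wk.
have Dz : Dr (Psi y) (DY N y v) = 0 by rewrite v4 (blin0 (sder_blin (rD _))).
have tail n : (k < n)%N -> G (Tn n y) (Tn n v) = 0.
  move=> kn; rewrite (Tn_eq0 hB (n := n) (x := v)) ?(blin0 (blin_G hN _))// => i ni.
  by apply: v1; exact: leq_trans ni.
(* A positive margin at [n] gives weight 1 from [n] on, so [v] has no coordinate from [n] to
   [k - 1], and [Tn n v = e k]. *)
have head n : (n <= k)%N -> ppos (margin n y) * G (Tn n y) (Tn n v) = ppos (margin n y) * G (Tn n y) (e k).
  move=> nk; case: (pposE (margin n y)) => [[h ->]|[_ ->]]; last by rewrite !mul0r.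
  have [->|a0] := eqVneq (margin n y) 0; first by rewrite !mul0r.
  have ap : 0 < margin n y by rewrite lt_def a0.
  congr (_ * G _ _); apply: (co_inj hB) => i; rewrite co_Tn// co_e//.
  case: ltnP => ni.
    by rewrite ltn_eqF//; exact: leq_trans nk.
  case: (ltngtP i k) => [ik|ki|->]; [|exact: v1|exact: v2].
  by apply: v3 => //; exact: margin_w hs ap ni.
suff Esum : \sum_(a < d) lam a * Dpert e r Dr d a y (DY N y) v =
    - \sum_(n < k.+1) crit_coef d lam y n * G (Tn n y) (e k).
  by rewrite -[LHS]opprK -Esum hD// oppr0.
rewrite -sumrN.
have -> : \sum_(a < d) lam a * Dpert e r Dr d a y (DY N y) v =
  \sum_(a < d) \sum_(n < k.+1) lam a * (- (wt R d a n * (2 * (ppos (margin n y) * G (Tn n y) (e k))))).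
  apply: eq_bigr => a _; rewrite -mulr_sumr; congr (_ * _).
  rewrite /Dpert (@gsum_fin _ _ k.+1); last first.
    by move=> n kn; rewrite /Dpert_term Dz tail// mulr0 mul0r subrr !mulr0.
  apply: eq_bigr => n _; rewrite -head; last by rewrite -ltnS.
  by rewrite /Dpert_term Dz mulr0 mul0r sub0r !mulrN -mulrA.
rewrite exchange_big /=; apply: eq_bigr => n _.
under eq_bigr => a _ do rewrite mulrN (mulrA (lam a)).
by rewrite sumrN -mulr_suml sum_wt// /crit_coef -!mulrA.
Qed.

(* Where [co y n = 0] the tail does not change at [n]; elsewhere the partial sum vanishes by
   induction.  Summation by parts leaves only the last term. *)
Lemma abel_zero (b : nat -> R) y :
  (forall k, \sum_(n < k.+1) b n * G (Tn n y) (e k) = 0) ->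
  forall k, co y k != 0 -> \sum_(n < k.+1) b n = 0.
Proof.
move=> hb k; elim/ltn_ind: k => k IH yk.
pose Bs n := \sum_(i < n) b i.
have step n : (n <= k)%N -> \sum_(i < n.+1) b i * G (Tn i y) (e k) = Bs n.+1 * G (Tn n y) (e k).
  elim: n => [|n IHn] nk; first by rewrite /Bs !big_ord1.
  rewrite big_ord_recr /= IHn ?(ltnW nk)// /Bs [in RHS]big_ord_recr /= mulrDl.
  congr (_ + _); have [yn|yn] := eqVneq (co y n) 0.
    by rewrite TnS yn scale0r subr0.
  by rewrite [\sum_(i < n.+1) b i]IH// !mul0r.
have := hb k; rewrite step// => /eqP; rewrite mulf_eq0 => /orP[/eqP//|].
rewrite (negbTE (G_e_neq0 hB hN hS _))// co_Tn// ltnn//.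
Qed.

(** Subtraction leaves the terms from [k.+1] to [k']. The first has maximal weight and absolute
    value at least [c k.+1 * L / 4], while the rest, by the ratio 1/8, add up to at most
    [c k.+1 * L / 14]. *)
Lemma dominance d (lam : nat -> R) y k k' (a : nat) : (k < k')%N -> ((k.+1) %% d)%N = a ->
  lam a != 0 -> (forall i, `|lam (i %% d)%N| <= `|lam a|) -> 0 < r (Psi y) ->
  (forall n, (k < n)%N -> 8 * Q n y <= r (Psi y) * r (Psi y)) ->
  \sum_(n < k.+1) crit_coef d lam y n = 0 -> \sum_(n < k'.+1) crit_coef d lam y n = 0 -> False.
Proof.
move=> kk' ka la lmax rP hQ h1 h2.
pose L := `|lam a| * (r (Psi y) * r (Psi y)).
have L0 : 0 < L by rewrite mulr_gt0 ?normr_gt0// mulr_gt0.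
have abd n : (k < n)%N -> r (Psi y) * r (Psi y) / 8 <= ppos (margin n y) <= r (Psi y) * r (Psi y) / 4.
  move=> kn; have := hQ n kn; have := Q_gt0 e n y => q0 q1.
  have h : 0 <= margin n y by rewrite /margin; have := mulr_gt0 rP rP; lra.
  by rewrite ppos_id// /margin; lra.
pose c n : R := (8^-1) ^+ n.
have c0 n : 0 < c n by rewrite exprn_gt0// invr_gt0.
have ub n : (k < n)%N -> `|crit_coef d lam y n| <= c n * (L / 2).
  move=> kn; rewrite /crit_coef !normrM -/(c n) (gtr0_norm (c0 n)) normr_nat (ger0_norm (ppos_ge0 _)).
  have /andP[_ a2] := abd n kn.
  have -> : c n * (L / 2) = `|lam a| * c n * (2 * (r (Psi y) * r (Psi y) / 4)).
    by rewrite /L; field.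
  apply: ler_pM; rewrite ?mulr_ge0 ?ppos_ge0//; try exact: ltW.
    by apply: ler_wpM2r => //; exact: ltW.
  by rewrite ler_pM2l.
have lb : c k.+1 * (L / 4) <= `|crit_coef d lam y k.+1|.
  rewrite /crit_coef !normrM -/(c k.+1) (gtr0_norm (c0 _)) normr_nat (ger0_norm (ppos_ge0 _)) ka.
  have /andP[a2 _] := abd _ (ltnSn k).
  have -> : c k.+1 * (L / 4) = `|lam a| * c k.+1 * (2 * (r (Psi y) * r (Psi y) / 8)).
    by rewrite /L; field.
  apply: ler_wpM2l; first by rewrite mulr_ge0// ltW.
  by rewrite ler_pM2l.
have part m : `|\sum_(n < k.+2 + m) crit_coef d lam y n - \sum_(n < k.+2) crit_coef d lam y n|
    <= (c k.+1 - 8 * c (k.+1 + m).+1) * (L / 2) / 7.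
  elim: m => [|m IH].
    rewrite !addn0 subrr normr0.
    have -> : 8 * c k.+2 = c k.+1 by rewrite /c [in LHS]exprS; field.
    by rewrite subrr !mul0r.
  rewrite addnS big_ord_recr /= addrAC (le_trans (ler_normD _ _))//.
  have u := ub (k.+2 + m)%N (leq_trans (ltnW (ltnSn k.+1)) (leq_addr _ _)).
  have E1 : c (k.+1 + m).+1 = c (k.+2 + m)%N by [].
  have E2 : 8 * c (k.+1 + m.+1).+1 = c (k.+2 + m)%N.
    by rewrite addnS -addSn /c exprS; field.
  rewrite E2; rewrite E1 in IH; lra.
have kE : k'.+1 = (k.+2 + (k' - k.+1))%N by rewrite addSn subnKC.
have := part (k' - k.+1)%N; rewrite -kE h2 sub0r normrN big_ord_recr /= h1 add0r.
have := c0 (k.+1 + (k' - k.+1)).+1; set c' := c _ => c'0.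
have h3 : 0 <= c' * L by rewrite mulr_ge0// ltW.
have h4 : 0 < c k.+1 * L by rewrite mulr_gt0.
lra.
Qed.

End CriticalRelations.

(** * Coordinate subspaces *)

Section CoordinateSubspaces.
Variables (R : realType) (E : completeNormedModType R) (e : nat -> E).
Hypothesis hB : one_suppression_unconditional e.
Local Notation co := (co e).
Local Notation Tn := (Tn e).

Definition vanishing (I : pred nat) : set E := [set x | forall k, I k -> co x k = 0].

Lemma vanishing_closed I : closed_subspace (vanishing I).
Proof.
split.
  split; first by move=> k _; rewrite co0.
  split; first by move=> x y hx hy k Ik; rewrite coD// hx// hy// addr0.
  by move=> a x hx k Ik; rewrite coZ// hx// mulr0.
have -> : vanishing I = \bigcap_(k in [set k | I k]) ((co ^~ k) @^-1` [set 0]).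
  by apply/seteqP; split => x h k /h.
apply: closed_bigI => k _; apply: closed_comp; last exact: closed_eq.
by move=> x _; apply: (blin_cont (blin_co hB k)).
Qed.

(** Unconditionality enters here: a masked block of the series has multipliers 0 and 1 and is
    controlled by the tail of [x]. *)
Lemma mask_series (I : pred nat) x : exists l,
  series_to (fun i => if I i then co x i else 0) e l.
Proof.
apply: cauchy_seq_cvg => ep ep0; have ep2 : 0 < ep / 2 by rewrite divr_gt0.
have [N hN] := Tn_small hB x ep2; exists N => n Nn.
pose b i : R := if (N <= i)%N && I i then 1 else 0.
have -> : \sum_(i < n) (if I i then co x i else 0) *: e i -
    \sum_(i < N) (if I i then co x i else 0) *: e i = \sum_(i < n) b i *: (co x i *: e i).
  rewrite -(subnKC Nn) big_split_ord [in RHS]big_split_ord /=.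
  rewrite addrAC subrr add0r [X in _ = X + _]big1 ?add0r; last first.
    by move=> i _; rewrite /b leqNgt ltn_ord /= scale0r.
  apply: eq_bigr => i _; rewrite /b leq_addr /=.
  by case: ifP => _; rewrite ?scale1r ?scale0r.
apply: (@le_trans _ _ (2 * 1 * `|Tn N x|)).
  apply: mult_signed => // i hi; rewrite /b; first by case: ifP; rewrite ?normr1 ?normr0.
  by rewrite leqNgt hi.
have := hN N (leqnn N); lra.
Qed.

(** The complement consists of the vectors supported on [I]; the masked series provides the
    component in [vanishing I]. *)
Lemma vanishing_complemented I : complemented (vanishing I).
Proof.
exists (vanishing (predC I)); split; first exact: vanishing_closed.
split.
  move=> x hx hy; apply: (co_eq0 hB) => i; case: (boolP (I i)); first exact: hx.
  exact: hy.
move=> x; have [l hl] := mask_series (predC I) x.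
have cl := co_uniq hB hl.
exists l, (x - l); split; first by move=> k Ik; rewrite cl /= Ik.
split; last by rewrite addrC subrK.
by move=> k /= Ik; rewrite coB// cl /= Ik subrr.
Qed.

(** Otherwise the coordinates in [I] of [(size s).+1] distinct basis vectors could be expressed
    through [s], and an identity matrix would factor through dimension [size s]. *)
Lemma vanishing_infinite_codim (I : pred nat) : (forall N, exists2 k, (N <= k)%N & I k) ->
  infinite_codim (vanishing I).
Proof.
move=> hI s; apply: contrapT => h.
have {}h x : exists c : nat -> R, forall k, I k ->
    co x k = \sum_(j < size s) c j * co s`_j k.
  have [y [z [hy [[c hz] xyz]]]] : exists y z, vanishing I y /\ Defs.span s z /\ x = y + z.
    by apply: contrapT => h1; apply: h; exists x.
  exists c => k Ik; rewrite xyz coD// hy// add0r hz co_sum//.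
  by apply: eq_bigr => j _; rewrite coZ.
have /choice[nx hnx] : forall N, exists k, (N <= k)%N /\ I k.
  by move=> N; have [k ? ?] := hI N; exists k.
pose ks i := iter i (fun k => nx k.+1) (nx 0%N).
have ksI i : I (ks i) by case: i => [|i]; rewrite /ks /=; exact: (hnx _).2.
have ks_lt i j : (i < j)%N -> (ks i < ks j)%N.
  elim: j => [//|j IH]; rewrite ltnS leq_eqVlt => /orP[/eqP->|/IH h1]; first by have [] := hnx (ks j).+1.
  by apply: (ltn_trans h1); have [] := hnx (ks j).+1.
have ks_inj i j : (ks i == ks j) = (i == j).
  by case: (ltngtP i j) => [/ks_lt/ltn_eqF->|/ks_lt/gtn_eqF->|->]; rewrite ?eqxx.
have /choice[c hc] := fun i => h (e (ks i)).
pose C : 'M[R]_((size s).+1, size s) := \matrix_(i, j) c i j.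
pose D : 'M[R]_(size s, (size s).+1) := \matrix_(j, l) co s`_j (ks l).
have CD : C *m D = 1%:M.
  apply/matrixP => i l; rewrite !mxE.
  have := hc i (ks l) (ksI l); rewrite co_e// ks_inj => hil.
  rewrite eq_sym in hil; rewrite -val_eqE hil; apply: eq_bigr => j _; by rewrite !mxE.
have := mxrankM_maxl C D; rewrite CD mxrank1 => h1.
by have := leq_trans h1 (rank_leq_col C); rewrite ltnn.
Qed.

End CoordinateSubspaces.

(** * Functionals vanishing on the range of a linear map *)

Section NonSurjective.
Variables (R : realType) (E : normedModType R) (d : nat) (L : E -> 'rV[R]_d).
Hypothesis hL : blin L.

(** A matrix of maximal rank whose rows are values of [L] spans the range. Its rank is below [d], so
    a nonzero column of its cokernel matrix is the functional. *)
Lemma nonsurj_functional : ~ (forall w, exists v, L v = w) ->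
  exists lam : 'I_d -> R, (exists i, lam i != 0) /\ forall v, \sum_i lam i * L v ord0 i = 0.
Proof.
move=> nsurj.
pose P (k : nat) := `[< exists n (A : 'M[R]_(n, d)), (forall i, exists v, row i A = L v) /\ \rank A = k >].
have P0 : exists k, P k.
  by exists 0%N; apply/asboolP; exists 0%N, 0; split; [case|exact: mxrank0].
have Pd k : P k -> (k <= d)%N.
  by move=> /asboolP[n [A [_ <-]]]; exact: rank_leq_col.
have [k /asboolP[n [A [hA rA]]] kmax] := ex_maxnP P0 Pd.
have sub v : (L v <= A)%MS.
  have sA : (A <= col_mx A (L v))%MS by apply/submxP; exists (row_mx 1%:M 0);
    rewrite mul_row_col mul1mx mul0mx addr0.
  have sL : (L v <= col_mx A (L v))%MS by apply/submxP; exists (row_mx 0 1%:M);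
    rewrite mul_row_col mul0mx mul1mx add0r.
  have hP : P (\rank (col_mx A (L v))).
    apply/asboolP; exists (n + 1)%N, (col_mx A (L v)); split => // i.
    case: (split_ordP i) => j ->.
      by rewrite rowKu; exact: hA.
    by rewrite rowKd; exists v; rewrite (ord1 j) row_id.
  have := kmax _ hP; rewrite -rA => h1.
  have [h2 h3] := mxrank_leqif_sup sA.
  by apply: submx_trans sL _; rewrite -h3 eqn_leq h2.
have rd : (\rank A < d)%N.
  rewrite ltn_neqAle rank_leq_col andbT; apply/negP => /eqP rE; apply: nsurj => w.
  have fA : row_full A by rewrite /row_full rE.
  have /submxP[u ->] : (w <= A)%MS by exact: submx_full.
  have /choice[v hv] := hA.
  exists (\sum_i u ord0 i *: v i); rewrite (blin_sum _ _ _ hL) mulmx_sum_row.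
  by apply: eq_bigr => i _; rewrite (blinZ hL) hv.
have : cokermx A != 0.
  by rewrite -mxrank_eq0 mxrank_coker -lt0n subn_gt0.
move=> /eqP c0; have [i [j hij]] : exists i j, cokermx A i j != 0.
  apply: contrapT => h; apply: c0; apply/matrixP => i j; rewrite [RHS]mxE.
  by apply/eqP; apply: contrapT => /negP hij; apply: h; exists i, j.
exists (fun i => cokermx A i j); split; first by exists i.
move=> v; have /submxP[D hD] := sub v.
have : (L v *m cokermx A) ord0 j = 0 by rewrite hD -mulmxA mulmx_coker mulmx0 mxE.
rewrite mxE => h; apply: etrans h; apply: eq_bigr => k' _; exact: mulrC.
Qed.
End NonSurjective.

(** * The approximation *)

Section Assembly.
Variables (R : realType) (E : completeNormedModType R) (e : nat -> E) (d : nat).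
Variables (U : set E) (f : E -> 'rV[R]_d) (eps : E -> R).
Hypothesis hB : one_suppression_unconditional e.
Hypothesis hN : norm_C1_away_from_0 E.
Hypothesis oU : open U.
Hypothesis C1f : C1_on (@eucl R d) U f.
Hypothesis ceps : {within U, continuous eps}.
Hypothesis eps0 : forall x, U x -> 0 < eps x.

(* [d + 1] compares the Euclidean and sup norms; [79 + 80 + 4 <= 200] bounds [Df - Dg]. *)
Definition tol (x : E) : R := eps x / (200 * d.+1%:R).

(** The bounds [4 * t] leave room for the displacement and the dyadic bound [2 * r x] of
    [Psi_facts]. The last condition measures [n] through [dyadic R n], so that a single scale
    governs it too. *)
Definition Good (x : E) (t : R) : Prop :=
  [/\ t <= 1, t <= tol x,
     forall y, `|y - x| <= 4 * t -> [/\ U y, `|f y - f x| <= tol x &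
       forall v, `|'d f y v - 'd f x v| <= tol x * `|v|] &
     forall n v, dyadic R n <= 4 * t -> `|'d f x (Tn e n v)| <= tol x * `|v|].

Lemma Good_mono x s t : s <= t -> Good x t -> Good x s.
Proof.
move=> st [h1 h2 h3 h4]; split; [lra|lra| |].
- by move=> y hy; apply: h3; lra.
- by move=> n v hn; apply: h4; lra.
Qed.

Lemma f_sder x : U x -> sder f x ('d f x).
Proof. exact: C1_on_sder. Qed.

Lemma tol_gt0 x : U x -> 0 < tol x.
Proof. by move=> Ux; rewrite divr_gt0 ?eps0// mulr_gt0 ?ltr0n. Qed.

(** Near [x] the tolerance falls at most by half, so errors of [tol x / 4] for [f] and [tol x / 8]
    for derivatives, each incurred twice, still fit below it. *)
Lemma Good_near x : U x -> exists2 m : R, 0 < m &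
  exists2 V, nbhs x V & forall y, V y -> U y /\ Good y m.
Proof.
move=> Ux; have t0 := tol_gt0 Ux.
have nU : nbhs x U by exact: open_nbhs_nbhs.
have ce : {for x, continuous eps}.
  by move: ceps; rewrite continuous_open_subspace// => /(_ x); rewrite inE; apply.
have e2 : 0 < eps x / 2 by rewrite divr_gt0 ?eps0.
have nV0 : nbhs x [set y | `|eps x - eps y| < eps x / 2].
  by have /cvgrPdist_lt := ce; apply.
have t4 : 0 < tol x / 4 by rewrite divr_gt0.
have t8 : 0 < tol x / 8 by rewrite divr_gt0.
have nV1 : nbhs x [set y | `|f x - f y| < tol x / 4].
  by have /cvgrPdist_lt := sder_cont (f_sder Ux); apply.
have [V2 nV2 hV2] := sder_derclose (f_sder Ux) t8.
have [N hN1] := shrinking_row hB hN (sder_blin (f_sder Ux)) t8.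
have [dl dl0 hd] := nbhs_exr (filterI (filterI nU nV0) (filterI nV1 nV2)).
(* The first 8 keeps the ball of radius [4 * mu] around [y] within distance [dl] of [x]; the second
   forces [N <= n] in the last condition of [Good]. *)
pose mu := Num.min (Num.min 1 (tol x / 2)) (Num.min (dl / 8) (dyadic R N / 8)).
have hfN := dyadic_gt0 R N.
have mu0 : 0 < mu.
  by rewrite /mu !lt_min ltr01 /=; apply/and3P; split; apply: divr_gt0.
have m1 : mu <= 1 by rewrite !ge_min lexx.
have m2 : mu <= tol x / 2 by rewrite !ge_min lexx !orbT.
have m3 : mu <= dl / 8 by rewrite !ge_min lexx !orbT.
have m4 : mu <= dyadic R N / 8 by rewrite !ge_min lexx !orbT.
exists mu => //; exists [set y | `|y - x| < dl / 2]; first by apply: nbhs_ballr; rewrite divr_gt0.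
move=> y /= hy.
have hy' : `|y - x| < dl by lra.
have [[Uy ey] [fy V2y]] := hd y hy'; split => //.
rewrite /= in ey fy.
have ty : tol x / 2 <= tol y.
  rewrite /tol mulrAC; apply: ler_wpM2r; first by rewrite invr_ge0 mulr_ge0 ?ler0n.
  by move: ey; rewrite ltr_norml => /andP[]; lra.
have Dy := hV2 y _ V2y (f_sder Uy).
split => //; first exact: le_trans ty.
- move=> z hz; have hzx : `|z - x| < dl.
    have := ler_distD y z x; lra.
  have [[Uz _] [fz V2z]] := hd z hzx; rewrite /= in fz.
  have Dz := hV2 z _ V2z (f_sder Uz).
  split; first exact: Uz.
    have := ler_distD (f x) (f z) (f y); rewrite (distrC (f z) (f x)); lra.
  move=> v; have Dy' : `|'d f x v - 'd f y v| <= tol x / 8 * `|v| by rewrite distrC.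
  apply: (le_trans (ler_distD ('d f x v) _ _)); apply: (le_trans (lerD (Dz v) Dy')).
  have {Dy Dz Dy'} : tol x / 2 * `|v| <= tol y * `|v| by apply: ler_wpM2r.
  have : 0 <= tol x * `|v| by rewrite mulr_ge0// ltW.
  lra.
move=> n v hn; have Nn : (N <= n)%N.
  by rewrite leqNgt; apply/negP => nN; have := dyadic_le R (ltnW nN); lra.
have h3 : tol x / 8 * `|Tn e n v| <= tol x / 8 * `|v| by rewrite ler_pM2l// Tn_contr.
rewrite -['d f y _](subrK ('d f x (Tn e n v))).
apply: (le_trans (ler_normD _ _)).
apply: (le_trans (lerD (le_trans (Dy _) h3) (hN1 n Nn v))).
have {Dy hN1 hV2} : tol x / 2 * `|v| <= tol y * `|v| by apply: ler_wpM2r.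
have : 0 <= tol x * `|v| by rewrite mulr_ge0// ltW.
lra.
Qed.

End Assembly.


Theorem theorem3p2 (R : realType) (E : completeNormedModType R)
  (e : nat -> E) (d : nat) (U : set E) (f : E -> 'rV[R]_d) (eps : E -> R) :
  infinite_dimensional E ->
  norm_C1_away_from_0 E ->
  strictly_convex_norm E ->
  one_suppression_unconditional e ->
  open U ->
  C1_on (@eucl R d) U f ->
  {within U, continuous eps} ->
  (forall x, U x -> 0 < eps x) ->
  exists g : E -> 'rV[R]_d,
    C1_on (@eucl R d) U g /\
    (forall x, U x -> eucl (f x - g x) <= eps x) /\
    (forall x, U x -> opnorm (@eucl R d) (fun v => 'd f x v - 'd g x v) <= eps x) /\
    (forall x, U x -> exists V : set E, open V /\ V x /\
       exists (n : nat) (Es : nat -> set E),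
         (forall j, (j < n)%N ->
            closed_subspace (Es j) /\ complemented (Es j) /\ infinite_codim (Es j)) /\
         (forall y, critical_set U g y -> V y -> exists2 j, (j < n)%N & Es j y)).
Proof.
move=> _ hN hS hB oU C1f ceps eps0.
have eta0 : 0 < 256^-1 :> R by rewrite invr_gt0 ltr0n.
have [r [rD' [rlip [r0 [rG rU]]]]] := exists_radius hB hN eta0 (@Good_mono _ _ e _ U f eps)
   (Good_near hB hN oU C1f ceps eps0).
have /choice[Dr rD] := rD'.
have r1 x : r x <= 1.
  have [rx|] := ltP 0 (r x); first by have [_ []] := rG x rx.
  by move=> h; apply: (le_trans h).
pose Ps := Psi e r.
pose g x : 'rV[R]_d := f (Ps x) + \row_(a < d) pert e r d a x.
have main x : U x -> exists N, settled e r N x /\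
   sder g x (fun v => 'd f (Ps x) (DY e r Dr N x v) + \row_(a < d) Dpert e r Dr d a x (DY e r Dr N x) v) /\
   `|f x - g x| <= 200 * tol d eps x /\
   (forall v, `|'d f x v - ('d f (Ps x) (DY e r Dr N x v) +
      \row_(a < d) Dpert e r Dr d a x (DY e r Dr N x) v)| <= 200 * tol d eps x * `|v|) /\
   r x <= 2 * r (Ps x).
  move=> Ux; have rx := rU x Ux; have [_ [_ g2 g3 g4]] := rG x rx.
  have tx := tol_gt0 d eps0 Ux.
  have [N [i [hs sP b1 b2 [b3 b4 b5 b6 b7]]]] := Psi_facts hB hN rD r0 rlip rx.
  exists N; split => //.
  have hPx : `|Ps x - x| <= 4 * r x by rewrite distrC; apply: le_trans b5 _; lra.
  have [UP fP dP] := g3 _ hPx.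
  split.
    apply: sder_add; first exact: sder_comp sP (C1_on_sder oU C1f UP).
    by apply: sder_row => a; exact: pert_sder.
  split.
    rewrite /g opprD addrA (le_trans (ler_normB _ _))//.
    have h1 : `|f x - f (Ps x)| <= tol d eps x by rewrite distrC.
    have h2 : `|\row_(a < d) pert e r d a x| <= r x.
      apply: rV_norm_le => // a; rewrite mxE; exact: pert_bound.
    lra.
  split; last by [].
  move=> v; set A := DY e r Dr N x.
  (* The tail vector [v - A v] costs 79 tolerances, the move of the base point to [Ps x] costs 80,
     and the perturbation 4. *)
  have -> : 'd f x v - ('d f (Ps x) (A v) + \row_(a < d) Dpert e r Dr d a x A v) =
    'd f x (v - A v) - ('d f (Ps x) (A v) - 'd f x (A v)) - \row_(a < d) Dpert e r Dr d a x A v.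
    by rewrite linearB /= opprB addrA subrK opprD addrA.
  have k1 : `|'d f x (v - A v)| <= tol d eps x * (79 * `|v|).
    rewrite -(b3 v); apply: (le_trans (g4 i _ _)); first lra.
    by rewrite ler_pM2l// b1.
  have k2 : `|'d f (Ps x) (A v) - 'd f x (A v)| <= tol d eps x * (80 * `|v|).
    by apply: (le_trans (dP _)); rewrite ler_pM2l// b2.
  have k3 : `|\row_(a < d) Dpert e r Dr d a x A v| <= 4 * r x * `|v|.
    apply: rV_norm_le; first by rewrite mulr_ge0// mulr_ge0.
    by move=> a; rewrite mxE; apply: Dpert_bound => //; exact: b2.
  have k4 : 4 * r x * `|v| <= 4 * tol d eps x * `|v| by apply: ler_wpM2r => //; rewrite ler_pM2l.
  have k5 : 0 <= tol d eps x * `|v| by rewrite mulr_ge0// ltW.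
  apply: (le_trans (ler_normB _ _)); apply: (le_trans (lerD (ler_normB _ _) k3)); lra.
clearbody g.
have C0 : 0 < d.+1%:R :> R by rewrite ltr0n.
have tolE x : d.+1%:R * (200 * tol d eps x) = eps x by rewrite /tol; move: (d.+1%:R : R) C0 => D D0; field; rewrite gt_eqF.
exists g; split.
  apply: (sder_C1_on C0 (@eucl_le_norm R d)).
  by move=> x Ux; have [N [_ [hg _]]] := main x Ux; eexists; exact: hg.
split.
  move=> x Ux; have [N [_ [_ [h _]]]] := main x Ux.
  by apply: (le_trans (eucl_le_norm _)); rewrite -tolE ler_pM2l.
split.
  move=> x Ux; have [N [_ [hg [_ [h _]]]]] := main x Ux.
  apply: opnorm_le => v v1.
  apply: (le_trans (eucl_le_norm _)); rewrite -tolE ler_pM2l//.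
  apply: (le_trans (sder_diff_close hg h v)).
  by rewrite ler_piMr// mulr_ge0// ltW// (tol_gt0 d eps0).
move=> x Ux; have rx := rU x Ux.
(* Combined with [r y <= 2 * r (Ps y)], this constant yields the bound on [8 * Q e n y] that
   [dominance] needs. *)
have c0 : 0 < 64^-1 :> R by rewrite invr_gt0.
have [M [V hV hM]] := near_settled hB hN rD c0 rx.
exists V^°; split; first exact: open_interior.
split; first exact: hV.
(* Each residue modulo [d] splits into two classes. For [d = 0] the family is empty, and so is the
   critical set. *)
pose m := (2 * d)%N.
exists m, (fun j => vanishing e (fun k => (M <= k)%N && (k %% m == j)%N)); split.
  move=> j jm; split; first exact: vanishing_closed.
  split; first exact: vanishing_complemented.
  apply: (vanishing_infinite_codim hB) => N; have m0 : (0 < m)%N by apply: leq_ltn_trans jm.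
  exists ((M + N) * m + j)%N.
    by apply: leq_trans (leq_addl M N) _; apply: leq_trans (leq_addr _ _); rewrite leq_pmulr.
  rewrite modnMDl modn_small// eqxx andbT; apply: leq_trans (leq_addr _ _).
  by apply: leq_trans (leq_addr N M) _; rewrite leq_pmulr.
move=> y [Uy nsurj] Vy0; have Vy : V y := interior_subset Vy0.
have [ry hQ] := hM y Vy.
have [N [hs [hg [_ [_ rr]]]]] := main y Uy.
have [dg Eg] := sder_diff hg.
have [lam [[i0 li0] hlam]] := nonsurj_functional (diff_blin dg) nsurj.
have d0 : (0 < d)%N by apply: leq_ltn_trans (ltn_ord i0).
(* The functional is extended by 0 to all naturals; [crit_coef] reads it only below [d]. *)
pose l n : R := oapp lam 0 (insub n : option 'I_d).
have lE (i : 'I_d) : l i = lam i by rewrite /l valK.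
have rel := crit_rel hB hN rD r0 rlip (lam := l) d0 hs.
have {}rel : forall k, \sum_(n < k.+1) crit_coef e r d l y n * G (Tn e n y) (e k) = 0.
  (* Along directions killed by every [DY n], the part of [Dg] coming from [f] vanishes, and only
     the perturbation remains. *)
  apply: rel => v hv; rewrite -[RHS](hlam v); apply: eq_bigr => a _; rewrite lE Eg !mxE.
  by rewrite [X in 'd f (Ps y) X]hv linear0 mxE add0r.
pose a := [arg max_(i > i0) `|lam i|]%O.
have amax i : `|lam i| <= `|lam a|.
  by rewrite /a; case: arg_maxP => // b _; apply.
have la : lam a != 0.
  by rewrite -normr_gt0; apply: lt_le_trans (amax i0); rewrite normr_gt0.
have rP : 0 < r (Ps y) by move: rr ry; lra.
have hQ2 n : (M <= n)%N -> 8 * Q e n y <= r (Ps y) * r (Ps y).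
  move=> Mn; have := Q_mono hB y Mn.
  have : r y * r y <= (2 * r (Ps y)) * (2 * r (Ps y)) by apply: ler_pM.
  have := mulr_gt0 rP rP; lra.
have dm : (d %| m)%N by rewrite dvdn_mull.
(* The condition on [k.+1] places the coefficient of maximal weight immediately after [k]; [k'] may
   be any later nonzero coordinate. *)
have bad k k' : (M <= k)%N -> (k < k')%N -> (k.+1 %% d = a)%N -> co e y k != 0 -> co e y k' != 0 -> False.
  move=> Mk kk' ka yk yk'.
  apply: (@dominance R E e r d l y k k' a kk' ka) => //.
  - by rewrite lE.
  - by move=> i; rewrite (lE (Ordinal (ltn_pmod i d0))) lE.
  - by move=> n kn; apply: hQ2; apply: leq_trans Mk (ltnW kn).
  - exact: (abel_zero hB hN hS rel).
  - exact: (abel_zero hB hN hS rel).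
apply: contrapT => hno.
have nz j : (j < m)%N -> exists k, [/\ (M <= k)%N, (k %% m = j)%N & co e y k != 0].
  move=> jm; apply: contrapT => h; apply: hno; exists j => // k /andP[Mk /eqP kj].
  by apply/eqP; apply: contrapT => /negP yk; apply: h; exists k.
(* Both residues [a - 1] and [a - 1 + d] modulo [2 d] force [k + 1 = a] modulo [d], whence two
   distinct places. *)
have m0 : (0 < m)%N by rewrite muln_gt0.
have [k1 [Mk1 k1m yk1]] := nz ((a + m.-1) %% m)%N (ltn_pmod _ m0).
have [k2 [Mk2 k2m yk2]] := nz ((a + d + m.-1) %% m)%N (ltn_pmod _ m0).
(* Adding [m.-1] subtracts 1 modulo [m] without truncation at zero. *)
have succ k b : (k %% m = (b + m.-1) %% m)%N -> (k.+1 %% m = b %% m)%N.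
  move=> h; rewrite -addn1 -modnDml h modnDml -addnA addn1 prednK// modnDr//.
have s1 := succ _ _ k1m; have s2 := succ _ _ k2m.
have am : (a < m)%N by apply: leq_trans (ltn_ord a) _; rewrite leq_pmull.
have adm : (a + d < m)%N by rewrite /m mul2n -addnn ltn_add2r.
have e1 : (k1.+1 %% d = a)%N by rewrite -(modn_dvdm _ dm) s1 (modn_dvdm _ dm) modn_small.
have e2 : (k2.+1 %% d = a)%N by rewrite -(modn_dvdm _ dm) s2 (modn_dvdm _ dm) modnDr modn_small.
case: (ltngtP k1 k2) => [h|h|h].
- exact: bad Mk1 h e1 yk1 yk2.
- exact: bad Mk2 h e2 yk2 yk1.
- move: s1; rewrite h s2 !modn_small// => /eqP.
  by rewrite -{2}[nat_of_ord a]addn0 eqn_add2l gtn_eqF.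
Qed.
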